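(* Let $C>0$. For each $n\ge1$ let $\{A_j\}$ be a partition of the sphere $\{\mathbf x\in\mathbb R^3:|\mathbf x|=\sqrt n\}$ into sets each of diameter at most $C n^{1/4}$. Then for every $\epsilon>0$, $$\sum_j\big(\#(A_j\cap\mathcal E(n))\big)^2\ll_{C,\epsilon} n^{1/2+\epsilon}.$$
   Context: $\mathcal E(n)=\{\mathbf x\in\mathbb Z^3:|\mathbf x|^2=n\}$. *)

(* Defs.v *)
From Stdlib Require Import Reals ZArith List Classical ClassicalEpsilon.
Import ListNotations.
Open Scope R_scope.

Definition pt : Type := (R * R * R)%type.

Definition normsq (p : pt) : R :=
  let '(x, y, z) := p in x * x + y * y + z * z.

Definition dist3 (p q : pt) : R :=
  let '(x1, y1, z1) := p in let '(x2, y2, z2) := q in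
  sqrt ((x1 - x2) * (x1 - x2) + (y1 - y2) * (y1 - y2) + (z1 - z2) * (z1 - z2)).

Definition sphere (n : nat) (p : pt) : Prop := sqrt (normsq p) = sqrt (INR n).

Definition zrange (n : nat) : list Z :=
  map (fun k => (Z.of_nat k - Z.of_nat n)%Z) (seq 0 (2 * n + 1)).

(* E(n) = {x in Z^3 : |x|^2 = n}, as a duplicate-free list. *)
Definition Elist (n : nat) : list (Z * Z * Z) :=
  filter (fun v => let '(a, b, c) := v in Z.eqb (a * a + b * b + c * c) (Z.of_nat n))
    (list_prod (list_prod (zrange n) (zrange n)) (zrange n)).

Definition embed (v : Z * Z * Z) : pt :=
  let '(a, b, c) := v in (IZR a, IZR b, IZR c).

Definition decP (P : Prop) : bool :=
  if excluded_middle_informative P then true else false.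

Definition countE (A : pt -> Prop) (n : nat) : nat :=
  length (filter (fun v => decP (A (embed v))) (Elist n)).

Definition is_partition {I : Type} (S : pt -> Prop) (A : I -> pt -> Prop) : Prop :=
  (forall j p, A j p -> S p) /\
  (forall p, S p -> exists j, A j p) /\
  (forall i j p, A i p -> A j p -> i = j).

Definition diam_le (A : pt -> Prop) (d : R) : Prop :=
  forall p q, A p -> A q -> dist3 p q <= d.

Definition sumR (l : list R) : R := fold_right Rplus 0 l.

(* Main.v *)
Require Import Defs.
From Stdlib Require Import Reals ZArith Znumtheory List FinFun Lia Lra Classical.
Import ListNotations.

(** The sum over j counts pairs (x, y) of points of E(n) lying in a common cell, so it is at most
    the number of pairs with |x - y|^2 = h <= C^2 n^(1/2). Put d = x - y and s = x + y: these are
    orthogonal, of norms h and 4n - h. Regard vectors as pure quaternions. For fixed h, any two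
    such (d, s) and (d0, s0) are conjugate by a primitive integral quaternion q, with
    q d0 = d q and q s0 = s q, so it suffices to count the possible q for a fixed (d0, s0).

    Let N be the norm of q. Modulo N, q is a left eigenvector of 2 d0 and of 2 s0, with integer
    eigenvalues l and m; since d0 and s0 anticommute, N divides 64 h (4n - h), which leaves
    n^o(1) values of N. With e the common content of N and 2 d0 - l, the reduced eigenvalue l / e
    is a square root of -4h/e^2 modulo N/e, and there are at most n^o(1) G/e of these, where G is
    the largest integer with G^2 | 16 h. Finally the q annihilating (2 d0 - l)/e modulo N/e form
    nearly a principal left ideal, generated by an element of norm about N/e, so that they are
    parametrised by quaternions of norm about e, and there are at most n^o(1) e of them.

    Hence each h contributes n^o(1) G(16 h), and summing over h <= H gives n^o(1) H. The values
    h = 0 and h = 4n, where d or s vanishes, contribute the number n^(1/2 + o(1)) of points. *)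

(** * Cardinality bounds for predicates *)

Section Counting.
Local Open Scope Z_scope.

(** Phrased through duplicate-free lists, so that a set can be bounded, and thereby shown finite,
    without enumerating it or deciding membership. *)
Definition at_most {T : Type} (P : T -> Prop) (B : Z) : Prop :=
  forall l, NoDup l -> (forall x, In x l -> P x) -> Z.of_nat (length l) <= B.

Definition Zsum (l : list Z) : Z := fold_right Z.add 0 l.

Lemma at_most_impl {T} (P Q : T -> Prop) (B C : Z) :
  at_most Q B -> (forall x, P x -> Q x) -> B <= C -> at_most P C.
Proof.
  intros HQ HPQ HBC l Hl HP.
  specialize (HQ l Hl (fun x Hx => HPQ x (HP x Hx))); lia.
Qed.

Lemma at_most_le {T} (P : T -> Prop) (B C : Z) : at_most P B -> B <= C -> at_most P C.
Proof.
  intros H HBC l Hl HP. specialize (H l Hl HP). lia.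
Qed.

Lemma at_most_nonneg {T} (P : T -> Prop) (B : Z) : at_most P B -> 0 <= B.
Proof.
  intros H. apply (H nil); [constructor | intros x []].
Qed.

Lemma at_most_one {T} (P : T -> Prop) :
  (forall x y, P x -> P y -> x = y) -> at_most P 1.
Proof.
  intros H [|a [|b l]] Hl HP; simpl length; try lia.
  exfalso. inversion Hl as [|? ? Hn]; subst. apply Hn. left.
  apply H; apply HP; simpl; auto.
Qed.

(** Lets a count fix one solution as a base point and compare the others with it. *)
Lemma at_most_if_inhabited {T} (P : T -> Prop) (B : Z) :
  0 <= B -> (forall x0, P x0 -> at_most P B) -> at_most P B.
Proof.
  intros HB H [|a l] Hl HP; [simpl; lia|].
  apply (H a); auto. apply HP; simpl; auto.
Qed.

Lemma at_most_list {T} (L : list T) : at_most (fun x => In x L) (Z.of_nat (length L)).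
Proof.
  intros l Hl HP. apply inj_le. apply NoDup_incl_length; auto.
Qed.

Lemma decP_true (P : Prop) : decP P = true <-> P.
Proof.
  unfold decP. destruct (ClassicalEpsilon.excluded_middle_informative P); intuition congruence.
Qed.

Lemma length_filter_split {T} (f : T -> bool) (l : list T) :
  length l = (length (filter f l) + length (filter (fun x => negb (f x)) l))%nat.
Proof.
  induction l as [|a l IH]; simpl; auto. destruct (f a); simpl; lia.
Qed.

(** [R] may relate x to several labels: x is charged to the first one in [L], and the induction
    continues with the elements not related to it. *)
Lemma at_most_fibers {T U} (P : T -> Prop) (R : T -> U -> Prop) (L : list U) (F : U -> Z) :
  (forall x, P x -> exists u, In u L /\ R x u) ->
  (forall u, In u L -> at_most (fun x => P x /\ R x u) (F u)) ->
  at_most P (Zsum (map F L)).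
Proof.
  revert P. induction L as [|u L IH]; intros P HP HF l Hl HPl.
  - destruct l as [|a l]; [simpl; lia|].
    destruct (HP a) as (u & [] & _). apply HPl; simpl; auto.
  - rewrite (length_filter_split (fun x => decP (R x u)) l). rewrite Nat2Z.inj_add.
    simpl. apply Z.add_le_mono.
    + apply (HF u); [simpl; auto | now apply NoDup_filter |].
      intros x [Hx Hd]%filter_In. apply (proj1 (decP_true _)) in Hd. split; auto.
    + apply (IH (fun x => P x /\ ~ R x u)).
      * intros x [Hx Hn]. destruct (HP x Hx) as (v & [<-|Hv] & HR); [contradiction|eauto].
      * intros v Hv. eapply at_most_impl; [apply (HF v); simpl; auto | | apply Z.le_refl].
        simpl. tauto.
      * now apply NoDup_filter.
      * intros x [Hx Hd]%filter_In. split; auto.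
        intros HR%decP_true. rewrite HR in Hd. discriminate.
Qed.

Lemma Zsum_const {U} (L : list U) (B : Z) :
  Zsum (map (fun _ => B) L) = Z.of_nat (length L) * B.
Proof.
  induction L as [|u L IH]; simpl map; simpl length; simpl Zsum; [lia|]. rewrite IH. lia.
Qed.

(** No list of all labels is at hand, so one label is chosen for each element of the given list; the
    distinct labels collected this way obey the bound [B]. *)
Lemma at_most_rel {T U} (P : T -> Prop) (Q : U -> Prop) (R : T -> U -> Prop) (B C : Z) :
  at_most Q B ->
  0 <= C ->
  (forall x, P x -> exists u, Q u /\ R x u) ->
  (forall u, Q u -> at_most (fun x => P x /\ R x u) C) ->
  at_most P (B * C).
Proof.
  intros HQ HC HR HF l Hl HP.
  assert (HL : exists L, NoDup L /\ (forall u, In u L -> Q u) /\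
                 forall x, In x l -> exists u, In u L /\ R x u).
  { clear Hl. induction l as [|a l IH].
    - exists nil. split; [constructor|]. split; intros x [].
    - destruct IH as (L & HL1 & HL2 & HL3); [intros x Hx; apply HP; simpl; auto|].
      destruct (HR a) as (u & Hu & Hau); [apply HP; simpl; auto|].
      destruct (classic (In u L)) as [Hin|Hin].
      + exists L. split; [auto|split; [auto|]]. intros x [<-|Hx]; eauto.
      + exists (u :: L). split; [now constructor|]. split.
        * intros v [<-|Hv]; auto.
        * intros x [<-|Hx]; [exists u; simpl; auto|].
          destruct (HL3 x Hx) as (v & Hv & HRv). exists v; simpl; auto. }
  destruct HL as (L & HL1 & HL2 & HL3).
  assert (H1 := HQ L HL1 HL2).
  assert (H2 : at_most (fun x => In x l) (Zsum (map (fun _ => C) L))).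
  { apply (at_most_fibers _ R); auto.
    intros u Hu. eapply at_most_impl; [apply (HF u); auto| |apply Z.le_refl].
    simpl. intros x [Hx Hxu]; auto. }
  rewrite Zsum_const in H2. specialize (H2 l Hl (fun x Hx => Hx)). nia.
Qed.

Lemma at_most_inj {T U} (P : T -> Prop) (Q : U -> Prop) (R : T -> U -> Prop) (B : Z) :
  at_most Q B ->
  (forall x, P x -> exists u, Q u /\ R x u) ->
  (forall x y u, P x -> P y -> R x u -> R y u -> x = y) ->
  at_most P B.
Proof.
  intros HQ HR HF. rewrite <- (Z.mul_1_r B). apply (at_most_rel P Q R); auto; [lia|].
  intros u Hu. apply at_most_one. intros x y [] []; eauto.
Qed.

Definition Zrange (a b : Z) : list Z :=
  map (fun i => a + Z.of_nat i) (seq 0 (Z.to_nat (b - a + 1))).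

Lemma in_Zrange (a b x : Z) : In x (Zrange a b) <-> a <= x <= b.
Proof.
  unfold Zrange. rewrite in_map_iff. split.
  - intros (i & <- & Hi%in_seq). lia.
  - intros Hx. exists (Z.to_nat (x - a)). split; [lia|]. apply in_seq. lia.
Qed.

Lemma length_Zrange (a b : Z) : a <= b + 1 -> Z.of_nat (length (Zrange a b)) = b - a + 1.
Proof.
  intros H. unfold Zrange. rewrite length_map, length_seq. lia.
Qed.

Lemma NoDup_Zrange (a b : Z) : NoDup (Zrange a b).
Proof.
  unfold Zrange. apply Injective_map_NoDup; [|apply seq_NoDup].
  intros i j Hij. lia.
Qed.

Lemma at_most_Zrange (a b : Z) : a <= b + 1 -> at_most (fun x => a <= x <= b) (b - a + 1).
Proof.
  intros H. rewrite <- (length_Zrange a b H).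
  eapply at_most_impl; [apply at_most_list| |apply Z.le_refl].
  intros x Hx. simpl. now apply in_Zrange.
Qed.

Lemma Z_least (P : Z -> Prop) (x : Z) :
  0 <= x -> P x -> exists m, 0 <= m /\ P m /\ forall y, 0 <= y -> P y -> m <= y.
Proof.
  induction x as [x IH] using (well_founded_induction (Z.lt_wf 0)). intros Hx HP.
  destruct (classic (exists y, 0 <= y < x /\ P y)) as [(y & Hy & HPy)|Hn].
  - apply (IH y); auto; lia.
  - exists x. split; [auto|split; [auto|]]. intros y Hy HPy.
    destruct (Z_lt_le_dec y x); auto. exfalso. apply Hn. exists y; auto.
Qed.

End Counting.

(** * The divisor bound: m has m^o(1) divisors *)

Section DivisorBound.
Local Open Scope Z_scope.

Definition divisors_at_most (m B : Z) : Prop := at_most (fun d => 0 < d /\ (d | m)) B.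

Lemma prime_divisor_exists (m : Z) : 1 < m -> exists p, prime p /\ (p | m).
Proof.
  intros Hm.
  destruct (Z_least (fun x => 1 < x /\ (x | m)) m) as (p & _ & (Hp & Hpm) & Hmin);
    [lia | split; [lia | apply Z.divide_refl] |].
  exists p. split; auto. apply prime_alt. split; auto. intros n Hn Hnp.
  specialize (Hmin n). assert (p <= n); [|lia].
  apply Hmin; [lia|split; [lia|]]. eapply Z.divide_trans; eauto.
Qed.

Lemma prime_power_extraction (p m : Z) :
  1 < p -> 0 < m -> exists (a : nat) m', m = p ^ Z.of_nat a * m' /\ 0 < m' /\ ~ (p | m').
Proof.
  intros Hp Hm.
  induction m as [m IH] using (well_founded_induction (Z.lt_wf 0)).
  destruct (classic (p | m)) as [[c ->]|Hn].
  - destruct (IH c) as (a & m' & Hc & Hm' & Hd); [nia | nia |].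
    exists (S a), m'. split; [|auto]. rewrite Nat2Z.inj_succ, Z.pow_succ_r by lia.
    rewrite Hc at 1. ring.
  - exists O, m. split; [|auto]. simpl Z.of_nat. rewrite Z.pow_0_r. ring.
Qed.

Lemma divisor_of_prime_power_mul (p : Z) (a : nat) (m d : Z) :
  prime p -> (d | p ^ Z.of_nat a * m) -> 0 < d ->
  exists i d', 0 <= i <= Z.of_nat a /\ d = p ^ i * d' /\ (0 < d' /\ (d' | m)).
Proof.
  intros Hp. assert (Hp1 : 1 < p) by (apply prime_alt in Hp; destruct Hp; auto).
  revert d. induction a as [|a IH]; intros d Hd Hd0.
  - exists 0, d. simpl Z.of_nat in *. rewrite Z.pow_0_r in *. rewrite !Z.mul_1_l in *.
    repeat split; auto; lia.
  - rewrite Nat2Z.inj_succ, Z.pow_succ_r, <- Z.mul_assoc in Hd by lia.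
    destruct (classic (p | d)) as [[c ->]|Hn].
    + rewrite (Z.mul_comm c p) in Hd. apply Z.mul_divide_cancel_l in Hd; [|lia].
      destruct (IH c Hd) as (i & d' & Hi & -> & Hd'); [nia|].
      exists (Z.succ i), d'. split; [lia|]. split; auto.
      rewrite Z.pow_succ_r by lia. ring.
    + apply Gauss in Hd; [|apply rel_prime_sym, prime_rel_prime; auto].
      destruct (IH d Hd Hd0) as (i & d' & Hi & Hrest). exists i, d'. split; [lia|auto].
Qed.

Lemma divisors_at_most_prime_power (p : Z) (a : nat) (m B : Z) :
  prime p -> divisors_at_most m B ->
  divisors_at_most (p ^ Z.of_nat a * m) ((Z.of_nat a + 1) * B).
Proof.
  intros Hp HB.
  apply (at_most_rel _ (fun i => 0 <= i <= Z.of_nat a)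
           (fun d i => exists d', d = p ^ i * d' /\ (0 < d' /\ (d' | m)))).
  - eapply at_most_impl; [apply (at_most_Zrange 0 (Z.of_nat a)); lia | auto | lia].
  - eapply at_most_nonneg; eauto.
  - intros d [Hd0 Hd].
    destruct (divisor_of_prime_power_mul p a m d Hp Hd Hd0) as (i & d' & Hi & H).
    exists i. split; [lia|]. exists d'. auto.
  - intros i Hi.
    apply (at_most_inj _ (fun d' => 0 < d' /\ (d' | m)) (fun d d' => d = p ^ i * d')); auto.
    + intros d [_ (d' & Hd & Hd')]. eauto.
    + intros; congruence.
Qed.

(** With q = a / k one has a + 1 <= k (q + 1) <= k 2^q, and q k <= a. *)
Lemma succ_pow_le (k a : nat) :
  (0 < k)%nat -> (Z.of_nat a + 1) ^ Z.of_nat k <= Z.of_nat k ^ Z.of_nat k * 2 ^ Z.of_nat a.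
Proof.
  intros Hk.
  assert (H2 : forall q, 0 <= q -> q + 1 <= 2 ^ q).
  { apply natlike_ind; [simpl; lia|]. intros x Hx IH. rewrite Z.pow_succ_r; lia. }
  set (K := Z.of_nat k). set (A := Z.of_nat a).
  assert (HK : 0 < K) by (unfold K; lia). assert (HA : 0 <= A) by (unfold A; lia).
  pose proof (Z.div_mod A K ltac:(lia)). pose proof (Z.mod_pos_bound A K HK).
  assert (Hq : 0 <= A / K) by (apply Z.div_pos; lia).
  specialize (H2 _ Hq).
  apply Z.le_trans with ((K * 2 ^ (A / K)) ^ K).
  - apply Z.pow_le_mono_l. nia.
  - rewrite Z.pow_mul_l, <- Z.pow_mul_r by lia.
    apply Z.mul_le_mono_nonneg_l; [apply Z.pow_nonneg; lia|].
    apply Z.pow_le_mono_r; [lia|nia].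
Qed.

(** The parameter [b] allows an induction on the least admissible prime, from 2^k, where c = 1
    suffices, down to 2, where every m is covered. *)
Definition rough_divisor_bound (k : nat) (b c : Z) : Prop :=
  forall m, 0 < m -> (forall p, prime p -> (p | m) -> b <= p) ->
    exists B, 0 < B /\ divisors_at_most m B /\ B ^ Z.of_nat k <= c * m.

Lemma divisors_at_most_1 : divisors_at_most 1 1.
Proof.
  apply at_most_one. intros x y [Hx H1] [Hy H2].
  apply Z.divide_pos_le in H1; apply Z.divide_pos_le in H2; lia.
Qed.

(* A prime p >= 2^k contributes (a+1)^k <= 2^(ak) <= p^a. *)
Lemma rough_divisor_bound_large (k : nat) : rough_divisor_bound k (2 ^ Z.of_nat k) 1.
Proof.
  intros m. induction m as [m IH] using (well_founded_induction (Z.lt_wf 0)).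
  intros Hm Hp.
  destruct (Z.eq_dec m 1) as [->|Hm1].
  { exists 1. split; [lia|]. split; [apply divisors_at_most_1|]. rewrite Z.pow_1_l; lia. }
  destruct (prime_divisor_exists m) as (p & Hpp & Hpm); [lia|].
  assert (Hp1 : 1 < p) by (apply prime_alt in Hpp; destruct Hpp; auto).
  destruct (prime_power_extraction p m Hp1 Hm) as (a & m' & -> & Hm' & Hn).
  destruct a as [|a].
  { exfalso. apply Hn. simpl Z.of_nat in Hpm. rewrite Z.pow_0_r, Z.mul_1_l in Hpm. auto. }
  assert (Hpa : 2 <= p ^ Z.of_nat (S a)).
  { rewrite Nat2Z.inj_succ, Z.pow_succ_r by lia.
    assert (0 < p ^ Z.of_nat a) by (apply Z.pow_pos_nonneg; lia). nia. }
  destruct (IH m') as (B & HB0 & HB & HBk); [nia | auto | |].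
  { intros p' Hp' Hd. apply Hp; auto. apply Z.divide_mul_r; auto. }
  exists ((Z.of_nat (S a) + 1) * B). split; [nia|]. split.
  { apply divisors_at_most_prime_power; auto. }
  rewrite Z.pow_mul_l, Z.mul_1_l in *.
  specialize (Hp p Hpp Hpm).
  apply Z.mul_le_mono_nonneg; auto; try (apply Z.pow_nonneg; lia).
  apply Z.le_trans with ((2 ^ Z.of_nat (S a)) ^ Z.of_nat k).
  - apply Z.pow_le_mono_l. split; [lia|].
    generalize (Z.of_nat (S a)) (Nat2Z.is_nonneg (S a)).
    apply natlike_ind; [simpl; lia|]. intros x Hx H. rewrite Z.pow_succ_r; lia.
  - rewrite <- Z.pow_mul_r by lia. rewrite (Z.mul_comm (Z.of_nat (S a))).
    rewrite Z.pow_mul_r by lia. apply Z.pow_le_mono_l. lia.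
Qed.

(** If [b] is prime, its power b^a in m costs a factor k^k, since (a + 1)^k <= k^k 2^a <= k^k b^a.
    If [b] is not prime, no prime factor of m equals it. *)
Lemma rough_divisor_bound_step (k : nat) (b c : Z) :
  (0 < k)%nat -> 0 < c -> 2 <= b ->
  rough_divisor_bound k (b + 1) c -> rough_divisor_bound k b (Z.of_nat k ^ Z.of_nat k * c).
Proof.
  intros Hk Hc Hb HR m Hm Hp.
  set (Ck := Z.of_nat k ^ Z.of_nat k).
  assert (HCk : 0 < Ck) by (apply Z.pow_pos_nonneg; lia).
  destruct (classic (prime b)) as [Hbp|Hbp].
  - destruct (prime_power_extraction b m) as (a & m' & -> & Hm' & Hn); [lia|lia|].
    destruct (HR m') as (B & HB0 & HB & HBk); [auto| |].
    { intros p Hpp Hd. specialize (Hp p Hpp (Z.divide_mul_r _ _ _ Hd)).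
      assert (p <> b) by congruence. lia. }
    exists ((Z.of_nat a + 1) * B). split; [nia|]. split.
    { apply divisors_at_most_prime_power; auto. }
    rewrite Z.pow_mul_l.
    replace (Ck * c * (b ^ Z.of_nat a * m')) with ((Ck * b ^ Z.of_nat a) * (c * m')) by ring.
    apply Z.mul_le_mono_nonneg; auto; try (apply Z.pow_nonneg; lia).
    eapply Z.le_trans; [apply succ_pow_le; auto|].
    apply Z.mul_le_mono_nonneg_l; [lia|]. apply Z.pow_le_mono_l. lia.
  - destruct (HR m) as (B & HB0 & HB & HBk); [auto| |].
    { intros p Hpp Hd. specialize (Hp p Hpp Hd). assert (p <> b) by congruence. lia. }
    exists B. split; [auto|]. split; [auto|]. nia.
Qed.

Theorem divisor_bound (k : nat) :
  (0 < k)%nat ->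
  exists c, 0 < c /\ forall m, 0 < m ->
    exists B, 0 < B /\ divisors_at_most m B /\ B ^ Z.of_nat k <= c * m.
Proof.
  intros Hk.
  (* The constant gains a factor k^k at each of the 2^k - 2 steps from 2^k down to 2, so it depends
     on k alone. *)
  assert (H : forall i, 0 <= i -> i <= 2 ^ Z.of_nat k - 2 ->
            exists c, 0 < c /\ rough_divisor_bound k (2 ^ Z.of_nat k - i) c).
  { apply (natlike_ind (fun i => i <= _ -> _)).
    - intros _. exists 1. split; [lia|]. rewrite Z.sub_0_r. apply rough_divisor_bound_large.
    - intros i Hi IH Hi2. destruct IH as (c & Hc & HR); [lia|].
      exists (Z.of_nat k ^ Z.of_nat k * c). split.
      + apply Z.mul_pos_pos; auto. apply Z.pow_pos_nonneg; lia.
      + apply rough_divisor_bound_step; auto; [lia|].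
        replace (2 ^ Z.of_nat k - Z.succ i + 1) with (2 ^ Z.of_nat k - i) by lia. auto. }
  assert (H2 : 2 <= 2 ^ Z.of_nat k).
  { destruct k; [lia|]. rewrite Nat2Z.inj_succ, Z.pow_succ_r by lia.
    assert (0 < 2 ^ Z.of_nat k) by (apply Z.pow_pos_nonneg; lia). lia. }
  destruct (H (2 ^ Z.of_nat k - 2)) as (c & Hc & HR); [lia|lia|].
  exists c. split; auto. intros m Hm. apply HR; auto.
  intros p Hp _. apply prime_alt in Hp. destruct Hp. lia.
Qed.

(** A single [B] serving all m up to [X] lets the divisor counts of different integers be multiplied
    into powers of [B]. *)
Definition uniform_divisor_bound (X B : Z) : Prop :=
  0 < B /\ forall m, 0 < m <= X -> divisors_at_most m B.

Corollary uniform_divisor_bound_exists (k : nat) :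
  (0 < k)%nat ->
  exists c, 0 < c /\ forall X, 0 < X ->
    exists B, uniform_divisor_bound X B /\ B ^ Z.of_nat k <= c * X.
Proof.
  intros Hk. destruct (divisor_bound k Hk) as (c & Hc & H).
  exists c. split; auto. intros X HX.
  (* [B] is the integer k-th root of c X: every t with t^k <= c m <= c X is then at most [B], and
     minimality gives B^k <= c X. *)
  destruct (Z_least (fun x => c * X < (x + 1) ^ Z.of_nat k) (c * X)) as (B & HB0 & HB & Hmin).
  - nia.
  - apply Z.lt_le_trans with ((c * X + 1) ^ 1); [rewrite Z.pow_1_r; lia|].
    apply Z.pow_le_mono_r; nia.
  - assert (HB1 : 0 < B).
    { destruct (Z.eq_dec B 0) as [->|]; [|lia]. rewrite Z.pow_1_l in HB; nia. }
    exists B. split; [split; auto|].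
    + intros m Hm. destruct (H m) as (t & Ht0 & Ht & Htk); [lia|].
      eapply at_most_impl; [exact Ht|auto|].
      destruct (Z_lt_le_dec B t) as [Hlt|]; auto. exfalso.
      assert ((B + 1) ^ Z.of_nat k <= t ^ Z.of_nat k) by (apply Z.pow_le_mono_l; lia). nia.
    + destruct (Z_le_gt_dec (B ^ Z.of_nat k) (c * X)) as [|Hgt]; auto. exfalso.
      assert (B <= B - 1); [|lia]. apply Hmin; [lia|].
      replace (B - 1 + 1) with B by lia. lia.
Qed.

End DivisorBound.

(** * Square roots modulo N and sums of two, three and four squares *)

Section SumsOfSquares.
Local Open Scope Z_scope.

Lemma divide_mul_mul (a b c d : Z) : (a | b) -> (c | d) -> (a * c | b * d).
Proof.
  intros [u ->] [v ->]. exists (u * v). ring.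
Qed.

Lemma gcd_factor (a b : Z) :
  0 < a -> exists g a' b', g = Z.gcd a b /\ 0 < g /\ 0 < a' /\
    a = g * a' /\ b = g * b' /\ Z.gcd a' b' = 1.
Proof.
  intros Ha. set (g := Z.gcd a b).
  assert (Hg0 : 0 <= g) by apply Z.gcd_nonneg.
  assert (Hg : g <> 0) by (intros H; apply Z.gcd_eq_0_l in H; lia).
  destruct (Z.gcd_divide_l a b) as [a' Ha']. destruct (Z.gcd_divide_r a b) as [b' Hb'].
  fold g in Ha', Hb'. exists g, a', b'. repeat split; try lia; try nia.
  assert (H := Z.gcd_div_gcd a b g Hg eq_refl).
  rewrite Ha', Hb', !Z.div_mul in H by lia. exact H.
Qed.

(* If x0 is one root then N = N1 * N2 with N1 | x - x0 and N2 | x + x0 for every root x;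
   N1 determines x modulo lcm N1 N2 = N / f, where f = gcd N1 N2 satisfies f^2 | 4k. *)
Lemma sqrt_mod_at_most (N k B F : Z) :
  0 < N -> divisors_at_most N B ->
  (forall f, 0 < f -> (f * f | 4 * k) -> f <= F) ->
  at_most (fun x => 0 <= x < N /\ (N | x * x + k)) (B * F).
Proof.
  intros HN HB HF.
  assert (HF1 : 1 <= F) by (apply HF; [lia | exists (4 * k); ring]).
  apply at_most_if_inhabited.
  { apply at_most_nonneg in HB. nia. }
  intros x0 [Hx0 Hd0].
  apply (at_most_rel _ (fun N1 => 0 < N1 /\ (N1 | N))
    (fun x N1 => exists N2, N = N1 * N2 /\ (N1 | x - x0) /\ (N2 | x + x0))); auto; [lia| |].
  - intros x [Hx Hd].
    destruct (gcd_factor N (x - x0) HN) as (g & N2 & y & _ & Hg & HN2 & HNg & Hy & Hco).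
    exists g. split; [split; [auto|exists N2; lia]|].
    exists N2. split; [auto|]. split; [exists y; lia|].
    assert (H : (N | (x - x0) * (x + x0))).
    { replace ((x - x0) * (x + x0)) with ((x * x + k) - (x0 * x0 + k)) by ring.
      now apply Z.divide_sub_r. }
    rewrite Hy, HNg, <- Z.mul_assoc in H. apply Z.mul_divide_cancel_l in H; [|lia].
    apply Z.gauss in H; auto.
  - intros N1 [HN1 _].
    apply at_most_if_inhabited; [lia|].
    intros x1 [[Hx1 Hd1] (N2 & HNN & H1 & H2)].
    assert (HN2 : 0 < N2) by nia.
    destruct (gcd_factor N1 N2 HN1) as (f & a & b & _ & Hf & Ha & Hfa & Hfb & Hab).
    assert (Hb : 0 < b) by nia.
    (* f divides x1 - x0 and x1 + x0, hence 2 x0, while f^2 divides N and so x0^2 + k. *)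
    assert (Hf2 : f <= F).
    { apply HF; auto.
      assert (Hfx : (f | 2 * x0)).
      { replace (2 * x0) with ((x1 + x0) - (x1 - x0)) by ring. apply Z.divide_sub_r.
        - apply Z.divide_trans with N2; auto. exists b; lia.
        - apply Z.divide_trans with N1; auto. exists a; lia. }
      assert (HfN : (f * f | N)) by (exists (a * b); rewrite HNN, Hfa, Hfb; ring).
      replace (4 * k) with (4 * (x0 * x0 + k) - (2 * x0) * (2 * x0)) by ring.
      apply Z.divide_sub_r.
      - apply Z.divide_mul_r. eapply Z.divide_trans; eauto.
      - apply divide_mul_mul; auto. }
    apply at_most_impl with (Q := fun x => (0 <= x < N) /\ (f * a * b | x - x1)) (B := f); auto.
    + set (L := f * a * b). assert (HL : 0 < L) by (unfold L; nia).
      assert (HNL : N = L * f) by (rewrite HNN, Hfa, Hfb; unfold L; ring).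
      apply (at_most_inj _ (fun j => 0 <= j <= f - 1) (fun x j => x / L = j)).
      * eapply at_most_impl; [apply (at_most_Zrange 0 (f - 1)); lia|auto|lia].
      * intros x [Hx _]. exists (x / L). split; auto. split; [apply Z.div_pos; lia|].
        assert (x / L < f) by (apply Z.div_lt_upper_bound; lia). lia.
      * intros x y j [Hx [u Hu]] [Hy [v Hv]] Hxj Hyj.
        pose proof (Z.div_mod x L ltac:(lia)). pose proof (Z.div_mod y L ltac:(lia)).
        assert (x mod L = y mod L).
        { replace x with (y + (u - v) * L) by lia. apply Z.mod_add. lia. }
        congruence.
    + intros x [[Hx _] (N2' & HNN' & H1' & H2')]. split; auto.
      assert (N2' = N2) by nia. subst N2'.
      assert (Hl : (N1 | x - x1)).
      { replace (x - x1) with ((x - x0) - (x1 - x0)) by ring. now apply Z.divide_sub_r. }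
      assert (Hr : (N2 | x - x1)).
      { replace (x - x1) with ((x + x0) - (x1 + x0)) by ring. now apply Z.divide_sub_r. }
      destruct Hl as [u Hu]. rewrite Hu, Hfa, Hfb in *.
      assert (Hr' : (b | a * u)).
      { apply (Z.mul_divide_cancel_l b (a * u) f); [lia|].
        replace (f * (a * u)) with (u * (f * a)) by ring. auto. }
      apply Z.gauss in Hr'; [|now rewrite Z.gcd_comm].
      destruct Hr' as [w ->]. exists w. ring.
Qed.

(* A coprime representation k = x^2 + y^2 determines a square root y/x of -1 modulo k; two
   representations with the same root differ by a Gaussian unit. *)
Lemma coprime_two_squares_at_most (k B : Z) :
  0 < k -> divisors_at_most k B ->
  at_most (fun p => fst p * fst p + snd p * snd p = k /\ Z.gcd (fst p) (snd p) = 1) (8 * B).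
Proof.
  (* There are at most 2 B square roots of -1, because f^2 | 4 forces f <= 2, and 4 Gaussian units
     for each root. *)
  intros Hk HB. replace (8 * B) with ((B * 2) * 4) by ring.
  apply (at_most_rel _ (fun l => 0 <= l < k /\ (k | l * l + 1))
           (fun p l => (k | snd p - l * fst p))).
  - apply sqrt_mod_at_most; auto. intros f Hf Hd. apply Z.divide_pos_le in Hd; nia.
  - lia.
  - intros [x y] [Hxy Hg]. simpl in *.
    assert (Hgk : Z.gcd x k = 1).
    { apply Z.bezout_1_gcd. apply Z.gcd_bezout in Hg. destruct Hg as (u & v & Huv).
      (* Modulo x, squaring v y = 1 - u x gives v^2 k = 1; this is the resulting Bezout pair. *)
      exists (u * (1 + v * y) - v * v * x), (v * v).
      rewrite <- Hxy. transitivity ((u * x) * (1 + v * y) + (v * y) * (v * y)); [ring|].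
      replace (u * x) with (1 - v * y) by lia. ring. }
    apply Z.gcd_bezout in Hgk. destruct Hgk as (a & b & Hab).
    assert (Hay : (k | y - (a * y) mod k * x)).
    { exists (b * y + (a * y / k) * x). pose proof (Z.div_mod (a * y) k ltac:(lia)).
      replace ((a * y) mod k) with (a * y - k * (a * y / k)) by lia.
      transitivity (y - (a * x) * y + k * (a * y / k) * x); [ring|].
      replace (a * x) with (1 - b * k) by lia. ring. }
    exists ((a * y) mod k). split; auto. split; [apply Z.mod_pos_bound; auto|].
    set (l := (a * y) mod k) in *.
    destruct Hay as [t Ht].
    assert (H : (k | (x * x) * (l * l + 1))).
    { exists (1 - 2 * t * y + t * t * k). rewrite <- Hxy at 1.
      replace (x * x * (l * l + 1)) with ((l * x) * (l * x) + x * x) by ring.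
      replace (l * x) with (y - t * k) by lia.
      transitivity ((x * x + y * y) * 1 + k * (t * t * k - 2 * t * y)); [ring|].
      rewrite Hxy at 1. rewrite Hxy. ring. }
    rewrite <- Z.mul_assoc in H.
    assert (Hkx : Z.gcd k x = 1).
    { apply Z.bezout_1_gcd. exists b, a. lia. }
    apply Z.gauss in H; auto. apply Z.gauss in H; auto.
  - intros l [Hl Hd]. apply at_most_if_inhabited; [lia|].
    intros [x0 y0] [[H0 _] Hd0]. simpl in *.
    (* As Gaussian integers, conj(x0 + i y0) (x + i y) = k u; the common root makes the imaginary
       part divisible by k, and comparing norms makes u a unit. *)
    apply (at_most_inj _ (fun u => In u [(1, 0); (-1, 0); (0, 1); (0, -1)])
       (fun p u => x0 * fst p + y0 * snd p = k * fst u /\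
                   x0 * snd p - y0 * fst p = k * snd u)).
    + apply at_most_list.
    + intros [x y] [[H1 _] Hd1]. simpl in *.
      assert (Hw : (k | x0 * y - y0 * x)).
      { replace (x0 * y - y0 * x) with (x0 * (y - l * x) - x * (y0 - l * x0)) by ring.
        apply Z.divide_sub_r; apply Z.divide_mul_r; auto. }
      destruct Hw as [w Hw]. rewrite (Z.mul_comm w) in Hw.
      set (c := x0 * x + y0 * y).
      assert (Hc : c * c = k * k * (1 - w * w)).
      { transitivity (k * k - (x0 * y - y0 * x) * (x0 * y - y0 * x)); [|rewrite Hw; ring].
        rewrite <- H0 at 1. rewrite <- H1. unfold c. ring. }
      assert (Hw1 : -1 <= w <= 1).
      { assert (0 <= 1 - w * w); [|nia].
        apply (Z.mul_nonneg_cancel_l (k * k)); [nia|]. rewrite <- Hc. apply Z.square_nonneg. }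
      assert (Hcases : w = 0 /\ (c = k \/ c = - k) \/ (w = 1 \/ w = -1) /\ c = 0).
      { assert (w = 0 \/ w = 1 \/ w = -1) as [->|[->| ->]] by lia.
        - left. split; auto. assert ((c - k) * (c + k) = 0) by lia.
          apply Z.mul_eq_0 in H. lia.
        - right. split; auto. nia.
        - right. split; auto. nia. }
      unfold c in Hcases.
      destruct Hcases as [[-> [Hv|Hv]]|[[->| ->] Hv]];
        [exists (1, 0)|exists (-1, 0)|exists (0, 1)|exists (0, -1)]; simpl;
        (split; [tauto|split; lia]).
    + intros [x y] [x' y'] [u v] _ _. simpl. intros [Ha Hb] [Hc Hd'].
      assert (E1 : k * x = k * x').
      { rewrite <- H0.
        transitivity (x0 * (x0 * x + y0 * y) - y0 * (x0 * y - y0 * x)); [ring|].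
        rewrite Ha, Hb, <- Hc, <- Hd'. ring. }
      assert (E2 : k * y = k * y').
      { rewrite <- H0.
        transitivity (y0 * (x0 * x + y0 * y) + x0 * (x0 * y - y0 * x)); [ring|].
        rewrite Ha, Hb, <- Hc, <- Hd'. ring. }
      apply Z.mul_cancel_l in E1; [|lia]. apply Z.mul_cancel_l in E2; [|lia]. congruence.
Qed.

(** There are at most [B] values of g = gcd(x, y), and dividing by g leaves a coprime representation
    of c / g^2. *)
Lemma two_squares_at_most (X B c : Z) :
  uniform_divisor_bound X B -> 0 <= c <= X ->
  at_most (fun p => fst p * fst p + snd p * snd p = c) (8 * B * B).
Proof.
  intros [HB0 HB] Hc.
  destruct (Z.eq_dec c 0) as [->|Hc0].
  { eapply at_most_impl; [apply at_most_one with (P := fun p : Z * Z => p = (0, 0))| |nia].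
    - congruence.
    - intros [x y]; simpl; intros H. f_equal; nia. }
  replace (8 * B * B) with (B * (8 * B)) by ring.
  apply (at_most_rel _ (fun g => 0 < g /\ (g | c)) (fun p g => g = Z.gcd (fst p) (snd p))).
  - apply HB; lia.
  - lia.
  - intros [x y] H. simpl in *. exists (Z.gcd x y). split; auto. split.
    + assert (H0 := Z.gcd_nonneg x y). destruct (Z.eq_dec (Z.gcd x y) 0) as [E|]; [|lia].
      assert (x = 0) by (eapply Z.gcd_eq_0_l; eauto).
      assert (y = 0) by (eapply Z.gcd_eq_0_r; eauto). subst. lia.
    + rewrite <- H. apply Z.divide_add_r; apply Z.divide_mul_r;
        [apply Z.gcd_divide_l|apply Z.gcd_divide_r].
  - intros g [Hg Hgc]. apply at_most_if_inhabited; [lia|].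
    intros [x1 y1] [H1 Hg1]. simpl in *.
    assert (Hgg : (g * g | c)).
    { rewrite <- H1. apply Z.divide_add_r; apply divide_mul_mul; rewrite Hg1;
        first [apply Z.gcd_divide_l|apply Z.gcd_divide_r]. }
    destruct Hgg as [k Hk]. assert (Hk0 : 0 < k) by nia.
    apply (at_most_inj _ (fun p => fst p * fst p + snd p * snd p = k /\ Z.gcd (fst p) (snd p) = 1)
       (fun p p' => fst p = g * fst p' /\ snd p = g * snd p')).
    + apply coprime_two_squares_at_most; auto. apply HB. assert (1 <= g * g) by nia. nia.
    + intros [x y] [Hxy Hgxy]. simpl in *.
      destruct (Z.gcd_divide_l x y) as [x' Hx']. destruct (Z.gcd_divide_r x y) as [y' Hy'].
      rewrite <- Hgxy in Hx', Hy'. exists (x', y'). simpl.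
      assert (Hq := Z.gcd_div_gcd x y g ltac:(lia) Hgxy).
      rewrite Hx', Hy', !Z.div_mul in Hq by lia.
      repeat split; auto; try lia.
      apply (Z.mul_cancel_l _ _ (g * g)); [nia|]. rewrite <- (Z.mul_comm k), <- Hk, <- Hxy.
      rewrite Hx', Hy'. ring.
    + intros [x y] [x' y'] [u v] _ _; simpl. intros [-> ->] [-> ->]. reflexivity.
Qed.

Lemma abs_le_sqrt (c z : Z) : z * z <= c -> - Z.sqrt c <= z <= Z.sqrt c.
Proof.
  intros H. assert (0 <= c) by nia.
  assert (Z.abs z <= Z.sqrt c); [|lia].
  rewrite <- (Z.sqrt_square (Z.abs z)) by lia. apply Z.sqrt_le_mono.
  rewrite <- Z.abs_mul. rewrite Z.abs_eq; nia.
Qed.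

Lemma three_squares_at_most (X B c : Z) :
  uniform_divisor_bound X B -> 0 <= c <= X ->
  at_most (fun p => fst (fst p) * fst (fst p) + snd (fst p) * snd (fst p) + snd p * snd p = c)
    ((2 * Z.sqrt c + 1) * (8 * B * B)).
Proof.
  intros HB Hc. assert (HB0 : 0 < B) by apply HB. assert (Hs := Z.sqrt_nonneg c).
  apply (at_most_rel _ (fun z => - Z.sqrt c <= z <= Z.sqrt c) (fun p z => z = snd p)).
  - eapply at_most_impl; [apply (at_most_Zrange (- Z.sqrt c) (Z.sqrt c)); lia|auto|lia].
  - nia.
  - intros [[x y] z] H; simpl in *. exists z. split; auto. apply abs_le_sqrt. nia.
  - intros z Hz.
    destruct (Z_lt_le_dec c (z * z)) as [Hlt|Hle].
    + intros [|[[x y] z'] l] Hl HP; [simpl length; nia|]. exfalso.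
      destruct (HP (x, y, z')) as [H E]; [simpl; auto|]. simpl in *. subst. nia.
    + apply (at_most_inj _ (fun p => fst p * fst p + snd p * snd p = c - z * z)
               (fun p p' => p' = fst p)).
      * apply (two_squares_at_most X); auto. nia.
      * intros [[x y] z'] [H E]; simpl in *. exists (x, y). split; auto. simpl. subst. lia.
      * intros [p z1] [p' z2] u [_ E1] [_ E2]; simpl in *. congruence.
Qed.

Lemma four_squares_at_most (X B c : Z) :
  uniform_divisor_bound X B -> 0 < c <= X ->
  at_most (fun p => fst (fst (fst p)) * fst (fst (fst p)) + snd (fst (fst p)) * snd (fst (fst p))
                    + snd (fst p) * snd (fst p) + snd p * snd p = c)
    (72 * c * B * B).
Proof.
  intros HB Hc. assert (HB0 : 0 < B) by apply HB. assert (Hs := Z.sqrt_nonneg c).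
  apply at_most_le with ((2 * Z.sqrt c + 1) * ((2 * Z.sqrt c + 1) * (8 * B * B))).
  - apply (at_most_rel _ (fun z => - Z.sqrt c <= z <= Z.sqrt c) (fun p z => z = snd p)).
    + eapply at_most_impl; [apply (at_most_Zrange (- Z.sqrt c) (Z.sqrt c)); lia|auto|lia].
    + nia.
    + intros [[[x y] w] z] H; simpl in *. exists z. split; auto. apply abs_le_sqrt. nia.
    + intros z Hz.
      destruct (Z_lt_le_dec c (z * z)) as [Hlt|Hle].
      * intros [|[[[x y] w] z'] l] Hl HP; [simpl length; nia|]. exfalso.
        destruct (HP (x, y, w, z')) as [H E]; [simpl; auto|]. simpl in *. subst. nia.
      * apply (at_most_inj _ (fun p => fst (fst p) * fst (fst p) + snd (fst p) * snd (fst p)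
                    + snd p * snd p = c - z * z) (fun p p' => p' = fst p)).
        -- eapply at_most_impl; [apply (three_squares_at_most X B (c - z * z)); auto; nia|auto|].
           assert (Z.sqrt (c - z * z) <= Z.sqrt c) by (apply Z.sqrt_le_mono; nia).
           nia.
        -- intros [[[x y] w] z'] [H E]; simpl in *. exists (x, y, w). split; auto. simpl. subst. lia.
        -- intros [p z1] [p' z2] u [_ E1] [_ E2]; simpl in *. congruence.
  - assert (Z.sqrt c * Z.sqrt c <= c) by (apply Z.sqrt_spec; lia).
    (* With s = [Z.sqrt c], the inequalities s <= s^2 <= c and 1 <= c give 4 s^2 + 4 s + 1 <= 9 c,
       whence the constant 72 = 9 * 8. *)
    assert ((2 * Z.sqrt c + 1) * (2 * Z.sqrt c + 1) <= 9 * c) by nia.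
    nia.
Qed.

End SumsOfSquares.

(** * Integral quaternions: algebra, norm and content *)

Section Quaternions.
Local Open Scope Z_scope.

(** Integer coordinates only, that is, the Lipschitz order. It is not Euclidean, which costs bounded
    factors 2 and 4 in the ideal arguments below. *)
Record quat := Quat { q0 : Z; q1 : Z; q2 : Z; q3 : Z }.

Definition qreal (k : Z) : quat := Quat k 0 0 0.

Definition qadd (x y : quat) : quat :=
  Quat (q0 x + q0 y) (q1 x + q1 y) (q2 x + q2 y) (q3 x + q3 y).

Definition qscale (k : Z) (x : quat) : quat := Quat (k * q0 x) (k * q1 x) (k * q2 x) (k * q3 x).

Definition qsub (x y : quat) : quat :=
  Quat (q0 x - q0 y) (q1 x - q1 y) (q2 x - q2 y) (q3 x - q3 y).

Definition qmul (x y : quat) : quat :=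
  Quat (q0 x * q0 y - q1 x * q1 y - q2 x * q2 y - q3 x * q3 y)
       (q0 x * q1 y + q1 x * q0 y + q2 x * q3 y - q3 x * q2 y)
       (q0 x * q2 y - q1 x * q3 y + q2 x * q0 y + q3 x * q1 y)
       (q0 x * q3 y + q1 x * q2 y - q2 x * q1 y + q3 x * q0 y).

Definition qconj (x : quat) : quat := Quat (q0 x) (- q1 x) (- q2 x) (- q3 x).

Definition qnorm (x : quat) : Z := q0 x * q0 x + q1 x * q1 x + q2 x * q2 x + q3 x * q3 x.

Definition qcont (x : quat) : Z := Z.gcd (q0 x) (Z.gcd (q1 x) (Z.gcd (q2 x) (q3 x))).

Declare Scope quat_scope.
Delimit Scope quat_scope with H.
Bind Scope quat_scope with quat.
Local Infix "+" := qadd : quat_scope.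
Local Infix "-" := qsub : quat_scope.
Local Infix "*" := qmul : quat_scope.
Local Notation "k *: x" := (qscale k%Z x%H) (at level 40, left associativity).

Ltac qsimpl := cbn [q0 q1 q2 q3 qadd qsub qscale qreal qconj] in *.

Ltac qring :=
  intros; repeat match goal with x : quat |- _ => destruct x end;
  unfold qmul, qadd, qsub, qscale, qconj, qreal, qnorm; cbn [q0 q1 q2 q3];
  try (f_equal; ring); try ring.

Lemma quat_eq (x y : quat) :
  q0 x = q0 y -> q1 x = q1 y -> q2 x = q2 y -> q3 x = q3 y -> x = y.
Proof. destruct x, y; simpl; congruence. Qed.

Lemma qmulA x y z : (x * (y * z) = x * y * z)%H. Proof. qring. Qed.
Lemma qmulDl x y z : ((x + y) * z = x * z + y * z)%H. Proof. qring. Qed.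
Lemma qmulDr x y z : (x * (y + z) = x * y + x * z)%H. Proof. qring. Qed.
Lemma qscale_mull k x y : ((k *: x) * y = k *: (x * y))%H. Proof. qring. Qed.
Lemma qscale_mulr k x y : (x * (k *: y) = k *: (x * y))%H. Proof. qring. Qed.
Lemma qscaleA k l x : k *: (l *: x) = (k * l) *: x. Proof. qring. Qed.
Lemma qscaleDr k x y : k *: (x + y) = (k *: x + k *: y)%H. Proof. qring. Qed.
Lemma qmul_conjr x : (x * qconj x)%H = qreal (qnorm x). Proof. qring. Qed.
Lemma qmul_conjl x : (qconj x * x)%H = qreal (qnorm x). Proof. qring. Qed.
Lemma qmul_realr x k : (x * qreal k)%H = k *: x. Proof. qring. Qed.
Lemma qmul_reall x k : (qreal k * x)%H = k *: x. Proof. qring. Qed.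
Lemma qnorm_mul x y : qnorm (x * y)%H = qnorm x * qnorm y. Proof. qring. Qed.
Lemma qnorm_conj x : qnorm (qconj x) = qnorm x. Proof. qring. Qed.
Lemma qnorm_scale k x : qnorm (k *: x) = k * k * qnorm x. Proof. qring. Qed.

Lemma qnorm_nonneg x : 0 <= qnorm x.
Proof. unfold qnorm. nia. Qed.

Lemma qnorm_eq_0 x : qnorm x = 0 -> x = qreal 0.
Proof. unfold qnorm. intros H. apply quat_eq; simpl; nia. Qed.

Lemma qscale_cancel k x y : k <> 0 -> k *: x = k *: y -> x = y.
Proof.
  intros Hk H. injection H as H0 H1 H2 H3.
  apply quat_eq; eapply Z.mul_cancel_l; eauto.
Qed.

(** As u varies, the real part of [u * x] runs over all integer combinations of the coordinates of
    x. *)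
Lemma qcont_bezout x : exists u, q0 (u * x)%H = qcont x.
Proof.
  destruct x as [a b c d]. unfold qcont; simpl.
  destruct (Z.gcd_bezout c d _ eq_refl) as (e & f & H1).
  destruct (Z.gcd_bezout b (Z.gcd c d) _ eq_refl) as (g & h & H2).
  destruct (Z.gcd_bezout a (Z.gcd b (Z.gcd c d)) _ eq_refl) as (i & j & H3).
  exists (Quat i (- (j * g)) (- (j * h * e)) (- (j * h * f))). simpl.
  rewrite <- H3, <- H2, <- H1. ring.
Qed.

Lemma qcont_divide x : exists y, x = qcont x *: y.
Proof.
  destruct x as [a b c d]. unfold qcont; simpl.
  set (g3 := Z.gcd c d). set (g2 := Z.gcd b g3). set (g := Z.gcd a g2).
  assert (Ha : (g | a)) by apply Z.gcd_divide_l.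
  assert (Hg2 : (g | g2)) by apply Z.gcd_divide_r.
  assert (Hb : (g | b)) by (apply Z.divide_trans with g2; [auto|apply Z.gcd_divide_l]).
  assert (Hg3 : (g | g3)) by (apply Z.divide_trans with g2; [auto|apply Z.gcd_divide_r]).
  assert (Hc : (g | c)) by (apply Z.divide_trans with g3; [auto|apply Z.gcd_divide_l]).
  assert (Hd : (g | d)) by (apply Z.divide_trans with g3; [auto|apply Z.gcd_divide_r]).
  destruct Ha as [a' Ha], Hb as [b' Hb], Hc as [c' Hc], Hd as [d' Hd].
  exists (Quat a' b' c' d'). unfold qscale; simpl. f_equal; lia.
Qed.

Lemma qcont_nonneg x : 0 <= qcont x.
Proof. apply Z.gcd_nonneg. Qed.

Lemma qcont_scale k x : 0 <= k -> qcont (k *: x) = k * qcont x.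
Proof.
  intros Hk. unfold qcont; simpl. rewrite !Z.gcd_mul_mono_l_nonneg; auto.
Qed.

Lemma qcont_eq_0 x : qcont x = 0 -> x = qreal 0.
Proof. intros H. destruct (qcont_divide x) as [y Hy]. rewrite Hy, H. qring. Qed.

(** * Primitive quaternions and eigenvalues modulo the norm *)

Lemma primitive_part x :
  x <> qreal 0 -> exists c y, 0 < c /\ x = c *: y /\ qcont y = 1.
Proof.
  intros Hx. destruct (qcont_divide x) as [y Hy].
  assert (Hc : 0 < qcont x).
  { pose proof (qcont_nonneg x). destruct (Z.eq_dec (qcont x) 0) as [E|]; [|lia].
    now apply qcont_eq_0 in E. }
  exists (qcont x), y. split; [auto|]. split; auto.
  assert (E : qcont x = qcont x * qcont y) by (rewrite <- qcont_scale by lia; congruence).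
  nia.
Qed.

Lemma primitive_norm_pos x : qcont x = 1 -> 0 < qnorm x.
Proof.
  intros H. pose proof (qnorm_nonneg x).
  destruct (Z.eq_dec (qnorm x) 0) as [E|]; [|lia].
  apply qnorm_eq_0 in E. subst. discriminate.
Qed.

(** Multiply on the left by u with [q0 (u * q) = 1] and compare real parts. *)
Lemma primitive_divide q m N r : qcont q = 1 -> m *: q = N *: r -> (N | m).
Proof.
  intros Hq H. destruct (qcont_bezout q) as [u Hu]. rewrite Hq in Hu.
  exists (q0 (u * r)%H).
  assert (E : (u * (m *: q))%H = (u * (N *: r))%H) by congruence.
  rewrite !qscale_mulr in E. apply (f_equal q0) in E. cbn -[qmul] in E. rewrite Hu in E. lia.
Qed.

(** Multiplying q g = N r on the right by conj g turns the left side into [qnorm g] times q. *)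
Lemma norm_divide_of_annihilates q g N r :
  qcont q = 1 -> (q * g)%H = N *: r -> (N | qnorm g).
Proof.
  intros Hq H. apply (primitive_divide q _ _ (r * qconj g)%H Hq).
  rewrite <- qmul_realr, <- qmul_conjr, qmulA, H. apply qscale_mull.
Qed.

(** Choose u with Re(u q) = 1, so that 2 q d0 = q d0 conj(u q) + q d0 u q. The first term is d q
    conj(q) conj(u), a multiple of the norm N; for the second, q x q = 2 Re(x q) q - N conj(x). Thus
    l = 2 Re(d0 u q). *)
Lemma intertwiner_eigenvalue q d0 d :
  qcont q = 1 -> (q * d0 = d * q)%H ->
  exists l r, (q * (2 *: d0) = l *: q + qnorm q *: r)%H.
Proof.
  intros Hq H. destruct (qcont_bezout q) as [u Hu]. rewrite Hq in Hu.
  exists (2 * q0 (d0 * u * q)%H), (d * qconj u - qconj (d0 * u))%H.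
  assert (E1 : (2 * q0 (u * q)%H) *: (q * d0) =
    (q * d0 * qconj q * qconj u + q * (d0 * u) * q)%H) by (clear; qring).
  rewrite Hu in E1. rewrite qscale_mulr. change (2 * 1) with 2 in E1. rewrite E1, H.
  assert (E2 : forall x, (q * x * q = (2 * q0 (x * q)%H) *: q - qnorm q *: qconj x)%H)
    by (clear; intros x; qring).
  rewrite E2. generalize (d0 * u)%H (q0 (d0 * u * q)%H). clear. qring.
Qed.

Definition annihilates (N : Z) (q g : quat) : Prop := exists r, (q * g)%H = N *: r.

Lemma annihilates_eigen N q x l :
  annihilates N q (x - qreal l)%H <-> exists r, (q * x = l *: q + N *: r)%H.
Proof.
  split; intros [r Hr]; exists r.
  - rewrite <- Hr. clear. qring.
  - assert (E : (q * (x - qreal l) = q * x - l *: q)%H) by (clear; qring).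
    rewrite E, Hr. clear. qring.
Qed.

Lemma pure_anticommutator x y :
  q0 x = 0 -> q0 y = 0 ->
  ((2 *: x) * (2 *: y) + (2 *: y) * (2 *: x))%H = qreal (8 * q0 (x * y)%H).
Proof.
  destruct x as [x0 x1 x2 x3], y as [y0 y1 y2 y3]. cbn [q0]. intros -> ->. qring.
Qed.

(* Both 2 d0 and 2 s0 act on q modulo N as scalars, yet they anticommute. *)
Lemma intertwiner_norm_divide q d0 s0 d s :
  q0 d0 = 0 -> q0 s0 = 0 -> q0 (d0 * s0)%H = 0 -> qcont q = 1 ->
  (q * d0 = d * q)%H -> (q * s0 = s * q)%H ->
  (qnorm q | 64 * (qnorm d0 * qnorm s0)).
Proof.
  intros Hd0 Hs0 Hort Hq Hd Hs.
  destruct (intertwiner_eigenvalue q d0 d Hq Hd) as (l & r & Hl).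
  destruct (intertwiner_eigenvalue q s0 s Hq Hs) as (m & t & Hm).
  set (N := qnorm q) in *.
  set (D := 2 *: d0) in *. set (S := 2 *: s0) in *.
  assert (HDS : (D * S + S * D)%H = qreal 0).
  { unfold D, S. rewrite pure_anticommutator by auto. rewrite Hort. reflexivity. }
  (* Modulo N, both q D S and q S D equal l m q, while their sum vanishes. *)
  assert (H2 : (N | 2 * (l * m))).
  { apply (primitive_divide q _ _ (qscale (-1) (m *: r + l *: t + (r * S + t * D)))%H Hq).
    assert (E : (q * (D * S + S * D))%H = qreal 0) by (rewrite HDS; clear; qring).
    rewrite qmulDr, !qmulA, Hl, Hm, !qmulDl, !qscale_mull, Hl, Hm in E.
    revert E. generalize (r * S)%H (t * D)%H. clear. intros x y E.
    injection E as E0 E1 E2 E3. apply quat_eq; qsimpl; lia. }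
  assert (Hdl : (N | 4 * qnorm d0 + l * l)).
  { replace (4 * qnorm d0 + l * l) with (qnorm (D - qreal l)%H).
    - destruct (proj2 (annihilates_eigen N q D l)) as [r' Hr']; [eauto|].
      eapply norm_divide_of_annihilates; eauto.
    - unfold D. destruct d0; qsimpl; subst. clear. qring. }
  assert (Hsm : (N | 4 * qnorm s0 + m * m)).
  { replace (4 * qnorm s0 + m * m) with (qnorm (S - qreal m)%H).
    - destruct (proj2 (annihilates_eigen N q S m)) as [r' Hr']; [eauto|].
      eapply norm_divide_of_annihilates; eauto.
    - unfold S. destruct s0; qsimpl; subst. clear. qring. }
  destruct H2 as [a Ha], Hdl as [b Hb], Hsm as [c Hc].
  (* This eliminates l and m: with h and M the norms of d0 and s0, 64 h M = 16 M (4 h + l^2) - 4 l^2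
     (4 M + m^2) + (2 l m)^2, and N divides each term. *)
  exists (b * (16 * qnorm s0) - 4 * l * l * c + (2 * (l * m)) * a).
  transitivity ((4 * qnorm d0 + l * l) * (16 * qnorm s0) - 4 * l * l * (4 * qnorm s0 + m * m)
                + (2 * (l * m)) * (2 * (l * m))); [ring|].
  rewrite Hb, Hc, (f_equal (Z.mul (2 * (l * m))) Ha). ring.
Qed.

(** * Division with remainder and annihilators modulo N *)

Lemma round_div (a M : Z) : 0 < M -> exists b c, a = M * b + c /\ - M <= 2 * c <= M.
Proof.
  intros HM. exists ((2 * a + M) / (2 * M)), (a - M * ((2 * a + M) / (2 * M))).
  split; [ring|].
  pose proof (Z.div_mod (2 * a + M) (2 * M) ltac:(lia)).
  pose proof (Z.mod_pos_bound (2 * a + M) (2 * M) ltac:(lia)). nia.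
Qed.

(* Rounding coordinatewise leaves a remainder of norm at most qnorm r; equality forces every
   coordinate of r^-1 x to be a half-integer, and then r divides 2 x. *)
Lemma lipschitz_division (r x : quat) :
  0 < qnorm r ->
  exists y, qnorm (x - r * y)%H < qnorm r \/ exists z, 2 *: x = (r * z)%H.
Proof.
  intros Hr. set (M := qnorm r) in *. set (w := (qconj r * x)%H).
  destruct (round_div (q0 w) M Hr) as (b0 & c0 & E0 & H0).
  destruct (round_div (q1 w) M Hr) as (b1 & c1 & E1 & H1).
  destruct (round_div (q2 w) M Hr) as (b2 & c2 & E2 & H2).
  destruct (round_div (q3 w) M Hr) as (b3 & c3 & E3 & H3).
  set (y := Quat b0 b1 b2 b3). set (c := Quat c0 c1 c2 c3).
  assert (Hw : w = (M *: y + c)%H) by (unfold y, c; apply quat_eq; qsimpl; lia).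
  exists y.
  assert (Hc : (qconj r * (x - r * y))%H = c).
  { assert (E : (qconj r * (x - r * y) = w - (qconj r * r) * y)%H)
      by (unfold w; clear; qring).
    rewrite E, Hw, qmul_conjl, qmul_reall. fold M. generalize (M *: y) c. clear. qring. }
  assert (HN : M * qnorm (x - r * y)%H = qnorm c).
  { rewrite <- Hc, qnorm_mul, qnorm_conj. reflexivity. }
  assert (S0 : 4 * (c0 * c0) <= M * M) by nia. assert (S1 : 4 * (c1 * c1) <= M * M) by nia.
  assert (S2 : 4 * (c2 * c2) <= M * M) by nia. assert (S3 : 4 * (c3 * c3) <= M * M) by nia.
  unfold qnorm at 2 in HN. cbn [c q0 q1 q2 q3] in HN.
  destruct (Z_lt_le_dec (qnorm (x - r * y)%H) M) as [Hlt|Hle]; [left; exact Hlt|right].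
  assert (Half : forall a, 4 * (a * a) = M * M -> exists t, 2 * a = M * t).
  { intros a Ha. assert (Hz : (2 * a - M) * (2 * a + M) = 0) by lia.
    apply Z.mul_eq_0 in Hz. destruct Hz; [exists 1|exists (-1)]; lia. }
  destruct (Half c0) as [t0 T0]; [nia|]. destruct (Half c1) as [t1 T1]; [nia|].
  destruct (Half c2) as [t2 T2]; [nia|]. destruct (Half c3) as [t3 T3]; [nia|].
  exists (2 *: y + Quat t0 t1 t2 t3)%H.
  apply (qscale_cancel M); [lia|].
  assert (EW : 2 *: w = M *: (2 *: y + Quat t0 t1 t2 t3)).
  { rewrite Hw. unfold c. apply quat_eq; qsimpl; lia. }
  rewrite <- qscale_mulr, <- EW. unfold w, M. clear. qring.
Qed.

(** Let r have least positive norm m in the right ideal generated by g and N. Division puts twice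
    the ideal inside the multiples of r, so 2 g = r t and 2 N = r x. Then m x = 2 N conj(r), which
    gives x g = N t, and x has norm 4 N^2 / m. *)
Lemma small_annihilator g N :
  0 < N -> (N | qnorm g) ->
  exists x k, 0 < k /\ qnorm x * k = 4 * N /\ annihilates N x g.
Proof.
  intros HN Hg.
  set (I := fun x => exists a b, x = (g * a + N *: b)%H).
  destruct (Z_least (fun m => 0 < m /\ exists x, I x /\ qnorm x = m) (N * N))
    as (m & Hm0 & (Hm & r & (a & b & Hr) & Hrm) & Hmin); [nia| |].
  { split; [nia|]. exists (qreal N). split; [|clear; qring].
    exists (qreal 0), (qreal 1). clear. qring. }
  assert (Hdiv : forall x, I x -> exists z, 2 *: x = (r * z)%H).
  { intros x (a' & b' & Hx).
    destruct (lipschitz_division r x) as (y & [Hlt|Hz]); [lia| |exact Hz].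
    assert (E : x = (r * y)%H).
    { assert (Hz : qnorm (x - r * y)%H = 0).
      { pose proof (qnorm_nonneg (x - r * y)%H) as Hnn.
        destruct (Z.eq_dec (qnorm (x - r * y)%H) 0) as [|Hne]; auto. exfalso.
        assert (m <= qnorm (x - r * y)%H); [|lia].
        apply Hmin; auto. split; [lia|]. eexists. split; [|reflexivity].
        exists (a' - a * y)%H, (b' - b * y)%H. rewrite Hx, Hr. clear. qring. }
      apply qnorm_eq_0 in Hz. revert Hz. generalize (r * y)%H. clear. intros z H.
      injection H as H0 H1 H2 H3. apply quat_eq; lia. }
    exists (2 *: y). rewrite E. clear. qring. }
  destruct (Hdiv g) as [t Ht].
  { exists (qreal 1), (qreal 0). clear. qring. }
  destruct (Hdiv (qreal N)) as [x Hx].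
  { exists (qreal 0), (qreal 1). clear. qring. }
  destruct Hg as [n Hn].
  (* Expanding the norm of g a + N b leaves [qnorm g * qnorm a] plus multiples of N, and N divides
     [qnorm g]. *)
  assert (Hk : exists k, m = N * k).
  { exists (n * qnorm a + 2 * q0 (g * a * qconj b)%H + N * qnorm b).
    rewrite <- Hrm, Hr.
    transitivity (qnorm g * qnorm a + N * (2 * q0 (g * a * qconj b)%H) + N * N * qnorm b).
    - clear. qring.
    - rewrite Hn. ring. }
  destruct Hk as [k Hk]. exists x, k.
  split; [nia|]. split.
  - apply (f_equal qnorm) in Hx. rewrite qnorm_mul, Hrm, Hk, qnorm_scale in Hx.
    assert (E : qnorm (qreal N) = N * N) by (clear; qring). rewrite E in Hx.
    apply (Z.mul_cancel_l _ _ N); lia.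
  - exists t. apply (qscale_cancel (m * 2)); [lia|].
    assert (Ex : m *: x = (2 * N) *: qconj r).
    { rewrite <- Hrm, <- qmul_reall, <- qmul_conjl, <- qmulA, <- Hx. clear. qring. }
    transitivity ((m *: x) * (2 *: g))%H; [clear; qring|].
    rewrite Ht, Ex. rewrite <- Hrm. clear. qring.
Qed.

(** In 2 Re(u g) q = q g u + q conj(u) conj(g), the first term on the right is 0 modulo N and Re(u
    g) is 1 modulo N. *)
Lemma annihilator_in_conj_ideal g N u m q :
  q0 (u * g)%H + m * N = 1 -> annihilates N q g ->
  exists a b, (2 *: q = a * qconj g + N *: b)%H.
Proof.
  intros Hu [r Hr]. exists (q * qconj u)%H, (r * u + (2 * m) *: q)%H.
  assert (E : (2 * q0 (u * g)%H) *: q = (q * g * u + q * qconj u * qconj g)%H) by (clear; qring).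
  rewrite Hr in E. replace (q0 (u * g)%H) with (1 - m * N) in E by lia.
  revert E. generalize (q * qconj u * qconj g)%H. clear. intros z E.
  assert (E' : 2 *: q = ((2 * (1 - m * N)) *: q + (2 * m * N) *: q)%H) by (clear; qring).
  rewrite E', E. clear. qring.
Qed.

(** Modulo N, both 2 q and 2 x are left multiples of conj(g), so 2 q conj(2 x) contains the factor
    conj(g) g, which is [qnorm g]. Hence q is determined by the quotient r, whatever the size of
    N. *)
Lemma annihilator_mul_conj g N q x :
  Z.gcd N (qcont g) = 1 -> (N | qnorm g) -> annihilates N q g -> annihilates N x g ->
  exists r, 4 *: (q * qconj x) = N *: r.
Proof.
  intros Hco [n Hn] Hq Hx.
  destruct (qcont_bezout g) as [u0 Hu0].
  apply Z.gcd_bezout in Hco. destruct Hco as (s & t & Hst).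
  assert (Hu : q0 (t *: u0 * g)%H + s * N = 1).
  { rewrite qscale_mull. cbn -[qmul]. rewrite Hu0. lia. }
  destruct (annihilator_in_conj_ideal g N _ _ q Hu Hq) as (a & b & Ha).
  destruct (annihilator_in_conj_ideal g N _ _ x Hu Hx) as (c & d & Hc).
  exists (n *: (a * qconj c) + a * qconj g * qconj d + b * qconj (2 *: x))%H.
  transitivity ((2 *: q) * qconj (2 *: x))%H; [clear; qring|].
  rewrite Ha, Hc.
  transitivity (qnorm g *: (a * qconj c) + N *: (a * qconj g * qconj d
      + b * qconj (c * qconj g + N *: d)))%H; [clear; qring|].
  rewrite Hn. generalize (a * qconj c)%H (a * qconj g * qconj d)%H
    (b * qconj (c * qconj g + N *: d))%H. clear. qring.
Qed.

Lemma qnorm_at_most (X B c : Z) :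
  uniform_divisor_bound X B -> 0 < c <= X ->
  at_most (fun x => qnorm x = c) (72 * c * B * B).
Proof.
  intros HB Hc.
  apply (at_most_inj _ _ (fun x p => p = (q0 x, q1 x, q2 x, q3 x)) _
           (four_squares_at_most X B c HB Hc)).
  - intros [a b d e] H. eexists. split; [|reflexivity]. exact H.
  - intros x y p _ _ -> H. injection H as H0 H1 H2 H3. now apply quat_eq.
Qed.

(** With x the small annihilator, of norm 4 N / k, the map q -> r given by 4 q conj(x) = N r is
    injective, and r has norm 64 e / k. Counting r by sums of four squares gives 4608 = 72 * 64. *)
Lemma annihilators_of_norm_at_most (X B N e : Z) (g : quat) :
  uniform_divisor_bound X B -> 0 < N -> 0 < e -> 64 * e <= X ->
  Z.gcd N (qcont g) = 1 -> (N | qnorm g) ->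
  at_most (fun q => qnorm q = e * N /\ annihilates N q g) (4608 * e * B * B).
Proof.
  intros HB HN He HX Hco Hg. assert (HB0 : 0 < B) by apply HB.
  destruct (small_annihilator g N HN Hg) as (x & k & Hk & Hxk & Hx).
  assert (Hx0 : 0 < qnorm x) by nia.
  apply at_most_if_inhabited; [nia|].
  assert (Hnorm : forall q r, qnorm q = e * N -> 4 *: (q * qconj x) = N *: r ->
             N * qnorm r = 16 * e * qnorm x).
  { intros q r Hq Hr. apply (f_equal qnorm) in Hr.
    rewrite !qnorm_scale, qnorm_mul, qnorm_conj, Hq in Hr.
    apply (Z.mul_cancel_l _ _ N); [lia|]. lia. }
  intros q1' [Hq1 Hann1].
  destruct (annihilator_mul_conj g N q1' x Hco Hg Hann1 Hx) as [r1 Hr1].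
  assert (H1 := Hnorm _ _ Hq1 Hr1).
  assert (Hc : qnorm r1 * k = 64 * e).
  { apply (Z.mul_cancel_l _ _ N); [lia|]. nia. }
  assert (Hc0 : 0 < qnorm r1) by (pose proof (qnorm_nonneg r1); nia).
  apply at_most_le with (72 * qnorm r1 * B * B).
  - apply (at_most_inj _ (fun r => qnorm r = qnorm r1)
             (fun q r => 4 *: (q * qconj x) = N *: r)).
    + apply (qnorm_at_most X); auto. nia.
    + intros q [Hq Hann].
      destruct (annihilator_mul_conj g N q x Hco Hg Hann Hx) as [r Hr].
      exists r. split; auto. assert (H := Hnorm _ _ Hq Hr).
      apply (Z.mul_cancel_l _ _ N); lia.
    + intros q q' r _ _ H H'. apply (qscale_cancel (4 * qnorm x)); [lia|].
      assert (E : forall z, (4 * qnorm x) *: z = ((4 *: (z * qconj x)) * x)%H)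
        by (clear; intros; qring).
      rewrite !E. congruence.
  - assert (qnorm r1 <= 64 * e) by nia.
    assert (0 <= B * B) by nia. nia.
Qed.

(** * Counting the intertwiners of a fixed orthogonal pair *)

(** Here [l] is the eigenvalue after division by [e], and [D] is 2 d0 / e. Removing the common
    content [e] makes D - l coprime in content to N', as the count of annihilators requires. *)
Definition eigen_datum (d0 : quat) (N e N' l : Z) (D : quat) : Prop :=
  0 < N' /\ N = e * N' /\ 2 *: d0 = e *: D /\ 0 <= l < N' /\
  Z.gcd N' (qcont (D - qreal l)%H) = 1 /\ (N' | qnorm (D - qreal l)%H).

Lemma eigen_datum_exists q d0 d :
  q0 d0 = 0 -> qcont q = 1 -> (q * d0 = d * q)%H ->
  exists e N' l D, 0 < e /\ eigen_datum d0 (qnorm q) e N' l D /\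
    annihilates N' q (D - qreal l)%H.
Proof.
  intros Hd0 Hq H.
  assert (HN := primitive_norm_pos q Hq).
  destruct (intertwiner_eigenvalue q d0 d Hq H) as (l0 & r0 & Hl0).
  set (N := qnorm q) in *. set (l1 := l0 mod N).
  assert (Hl1 : annihilates N q (2 *: d0 - qreal l1)%H).
  { apply annihilates_eigen. exists (r0 + (l0 / N) *: q)%H. rewrite Hl0.
    assert (E : l0 = N * (l0 / N) + l1) by (apply Z.div_mod; lia).
    rewrite E at 1. clear. qring. }
  assert (Hl1b : 0 <= l1 < N) by (apply Z.mod_pos_bound; auto).
  clearbody l1.
  destruct (gcd_factor N (qcont (2 *: d0 - qreal l1)%H) HN)
    as (e & N' & c & _ & He & HN' & HNe & Hc & Hco).
  destruct (qcont_divide (2 *: d0 - qreal l1)%H) as [g0 Hg0].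
  rewrite Hc in Hg0. set (g := c *: g0).
  assert (Hg : (2 *: d0 - qreal l1)%H = e *: g) by (rewrite Hg0; unfold g; clear; qring).
  assert (Hcg : qcont g = c).
  { rewrite Hg, qcont_scale in Hc by lia. nia. }
  clearbody g. clear Hg0 g0.
  (* As d0 is pure, the real part of 2 d0 - l1 is -l1; hence [e] divides l1, and so also 2 d0. *)
  assert (Hl : l1 = e * - q0 g).
  { apply (f_equal q0) in Hg. qsimpl. rewrite Hd0 in Hg. lia. }
  assert (HD : ((g + qreal (- q0 g)) - qreal (- q0 g) = g)%H) by (clear; qring).
  assert (Hann : annihilates N' q g).
  { destruct Hl1 as [r Hr]. exists r. apply (qscale_cancel e); [lia|].
    rewrite <- qscale_mulr, <- Hg, Hr, HNe. clear. qring. }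
  exists e, N', (- q0 g), (g + qreal (- q0 g))%H.
  split; [auto|]. unfold eigen_datum. rewrite HD, Hcg.
  split; [|exact Hann]. split; [auto|]. split; [auto|]. split.
  { rewrite qscaleDr, <- Hg. rewrite Hl. apply quat_eq; qsimpl; lia. }
  split; [nia|]. split; [auto|].
  destruct Hann as [r Hr]. eapply norm_divide_of_annihilates; eauto.
Qed.

(** Successive choices: [B] for the norm N, [B] for e, B (G / e) for the reduced eigenvalue and 4608
    e B^2 for q. The factor e cancels. *)
Lemma intertwiners_at_most (X B G : Z) (d0 s0 : quat) :
  q0 d0 = 0 -> q0 s0 = 0 -> q0 (d0 * s0)%H = 0 -> 0 < qnorm d0 -> 0 < qnorm s0 ->
  uniform_divisor_bound X B ->
  64 * (qnorm d0 * qnorm s0) <= X -> 256 * qnorm d0 <= X ->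
  (forall f, 0 < f -> (f * f | 16 * qnorm d0) -> f <= G) ->
  at_most (fun q => qcont q = 1 /\ exists d s, (q * d0 = d * q)%H /\ (q * s0 = s * q)%H)
    (4608 * (B * B * B * B * B) * G).
Proof.
  intros Hd0 Hs0 Hort Hh HM HB HX1 HX2 HG. assert (HB0 : 0 < B) by apply HB.
  assert (HG1 : 1 <= G) by (apply HG; [lia|exists (16 * qnorm d0); ring]).
  set (W := B * (4608 * B * B) * G). assert (HW : 0 <= W) by (unfold W; nia).
  replace (4608 * (B * B * B * B * B) * G) with (B * (B * W)) by (unfold W; ring).
  apply (at_most_rel _ (fun N => 0 < N /\ (N | 64 * (qnorm d0 * qnorm s0)))
           (fun q N => N = qnorm q)).
  { apply HB. nia. }
  { nia. }
  { intros q (Hq & d & s & Hd & Hs). exists (qnorm q). split; auto.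
    split; [now apply primitive_norm_pos|]. eapply intertwiner_norm_divide; eauto. }
  intros N [HN HNd].
  assert (HNX : N <= X) by (apply Z.divide_pos_le in HNd; nia).
  apply (at_most_rel _ (fun e => 0 < e /\ (e | 4 * qnorm d0))
    (fun q e => exists N' l D, eigen_datum d0 N e N' l D /\ annihilates N' q (D - qreal l)%H)).
  { apply HB. lia. }
  { auto. }
  { intros q [(Hq & d & s & Hd & Hs) ->].
    destruct (eigen_datum_exists q d0 d Hd0 Hq Hd) as (e & N' & l & D & He & Hdat & Hann).
    exists e. split; [|eauto]. split; auto.
    destruct Hdat as (_ & _ & HD & _). apply (f_equal qnorm) in HD.
    rewrite !qnorm_scale in HD. exists (e * qnorm D). lia. }
  intros e [He Hed].
  (* N' and D are determined by N, e and d0, so they may be read off from one solution. *)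
  apply at_most_if_inhabited; auto.
  intros qb [_ (N' & lb & D & (HN' & HNe & HD & _) & _)].
  assert (HnD : 4 * qnorm d0 = e * e * qnorm D).
  { apply (f_equal qnorm) in HD. rewrite !qnorm_scale in HD. lia. }
  assert (HD0 : q0 D = 0) by (apply (f_equal q0) in HD; qsimpl; nia).
  apply at_most_impl with
    (Q := fun q => qnorm q = N /\ exists l, 0 <= l < N' /\
       Z.gcd N' (qcont (D - qreal l)%H) = 1 /\ (N' | qnorm (D - qreal l)%H) /\
       annihilates N' q (D - qreal l)%H)
    (B := (B * (G / e)) * (4608 * e * B * B)).
  - assert (HnDl : forall l, qnorm (D - qreal l)%H = l * l + qnorm D).
    { intros l. destruct D; qsimpl; subst. clear. qring. }
    apply (at_most_rel _ (fun l => 0 <= l < N' /\ (N' | l * l + qnorm D))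
       (fun q l => Z.gcd N' (qcont (D - qreal l)%H) = 1 /\ (N' | qnorm (D - qreal l)%H) /\
       annihilates N' q (D - qreal l)%H)).
    + apply sqrt_mod_at_most; auto.
      * apply HB. nia.
      (* If f^2 divides 4 [qnorm D], then (e f)^2 divides 16 [qnorm d0], so e f <= G. *)
      * intros f Hf Hdiv. apply Z.div_le_lower_bound; auto.
        apply HG; [nia|]. replace (16 * qnorm d0) with (e * e * (4 * qnorm D)) by lia.
        replace (e * f * (e * f)) with (e * e * (f * f)) by ring.
        now apply Z.mul_divide_mono_l.
    + nia.
    + intros q [Hq (l & Hl & Hco & Hdiv & Hann)]. exists l. rewrite <- HnDl. auto.
    + intros l Hl. apply at_most_if_inhabited; [nia|].
      intros q1' (_ & Hco & Hdiv & _).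
      eapply at_most_impl;
        [apply (annihilators_of_norm_at_most X B N' e (D - qreal l)%H); auto| |apply Z.le_refl].
      * apply Z.divide_pos_le in Hed; lia.
      * intros q [[Hq _] (_ & _ & Hann)]. split; [lia|auto].
  - intros q [[_ ->] (N2 & l & D2 & (HN2 & HNe2 & HD2 & Hrest) & Hann)].
    assert (N2 = N') by nia. assert (D2 = D).
    { apply (qscale_cancel e); [lia|]. congruence. }
    subst N2 D2. split; auto. exists l. tauto.
  - assert (H1 : e * (G / e) <= G) by (apply Z.mul_div_le; auto).
    unfold W. replace (B * (G / e) * (4608 * e * B * B))
      with (B * (4608 * B * B) * (e * (G / e))) by ring.
    apply Z.mul_le_mono_nonneg_l; [nia|auto].
Qed.

(** * Existence of simultaneous intertwiners by averaging *)

Lemma qmulBl x y z : ((x - y) * z = x * z - y * z)%H. Proof. qring. Qed.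
Lemma qmulBr x y z : (x * (y - z) = x * y - x * z)%H. Proof. qring. Qed.

Lemma pure_square x : q0 x = 0 -> (x * x)%H = qreal (- qnorm x).
Proof. destruct x as [x0 x1 x2 x3]. cbn [q0]. intros ->. qring. Qed.

Lemma pure_orthogonal_swap x y :
  q0 x = 0 -> q0 y = 0 -> q0 (x * y)%H = 0 -> (y * x)%H = (-1) *: (x * y).
Proof.
  destruct x as [x0 x1 x2 x3], y as [y0 y1 y2 y3]. cbn [q0]. intros -> -> H.
  cbn [qmul q0 q1 q2 q3] in H. apply quat_eq; cbn [qmul qscale q0 q1 q2 q3]; lia.
Qed.

(** This is h M times the sum of g a g0^-1 over g = 1, d, s, d s with g0 = 1, d0, s0, d0 s0 in step.
    For orthogonal pure pairs all nontrivial g0 are pure, so their inverses are negative multiples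
    of themselves, whence the signs. *)
Definition averaged (h M : Z) (d s d0 s0 a : quat) : quat :=
  ((h * M) *: a - M *: (d * a * d0) - h *: (s * a * s0) - (d * s) * a * (d0 * s0))%H.

Definition orthogonal_pair (h M : Z) (d s : quat) : Prop :=
  q0 d = 0 /\ q0 s = 0 /\ q0 (d * s)%H = 0 /\ qnorm d = h /\ qnorm s = M.

(** Left multiplication by d and right multiplication by d0 match the four terms in the pairs 1, d
    and s, d s. *)
Lemma averaged_intertwines_fst h M d s d0 s0 a :
  orthogonal_pair h M d s -> orthogonal_pair h M d0 s0 ->
  (averaged h M d s d0 s0 a * d0 = d * averaged h M d s d0 s0 a)%H.
Proof.
  intros (Hd & Hs & Hds & Nd & Ns) (Hd0 & Hs0 & Hds0 & Nd0 & Ns0).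
  assert (Sd := pure_square d Hd). assert (Sd0 := pure_square d0 Hd0).
  rewrite Nd in Sd. rewrite Nd0 in Sd0.
  assert (W0 := pure_orthogonal_swap d0 s0 Hd0 Hs0 Hds0).
  unfold averaged. rewrite !qmulBr, !qmulBl, !qscale_mulr, !qscale_mull.
  assert (T2 : (d * (d * a * d0))%H = (- h) *: (a * d0)).
  { rewrite !qmulA, Sd, qmul_reall, qscale_mull. reflexivity. }
  assert (T4 : (d * (d * s * a * (d0 * s0)))%H = (- h) *: (s * a * (d0 * s0))).
  { rewrite !qmulA, Sd, qmul_reall, !qscale_mull. reflexivity. }
  assert (T2' : (d * a * d0 * d0)%H = (- h) *: (d * a)).
  { rewrite <- (qmulA (d * a)%H), Sd0, qmul_realr. reflexivity. }
  assert (T3' : (s * a * s0 * d0)%H = (-1) *: (s * a * (d0 * s0))).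
  { rewrite <- (qmulA (s * a)%H), W0, qscale_mulr. reflexivity. }
  assert (T4' : (d * s * a * (d0 * s0) * d0)%H = h *: (d * (s * a * s0))).
  { rewrite <- (qmulA (d * s * a)%H), <- (qmulA d0), W0, qscale_mulr, (qmulA d0), Sd0,
      qmul_reall, !qscale_mulr, qscaleA, !qmulA. f_equal. ring. }
  rewrite T2, T4, T2', T3', T4'.
  generalize (d * a)%H (a * d0)%H (s * a * (d0 * s0))%H (d * (s * a * s0))%H. clear. qring.
Qed.

Lemma averaged_intertwines_snd h M d s d0 s0 a :
  orthogonal_pair h M d s -> orthogonal_pair h M d0 s0 ->
  (averaged h M d s d0 s0 a * s0 = s * averaged h M d s d0 s0 a)%H.
Proof.
  intros (Hd & Hs & Hds & Nd & Ns) (Hd0 & Hs0 & Hds0 & Nd0 & Ns0).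
  assert (Ss := pure_square s Hs). assert (Ss0 := pure_square s0 Hs0).
  rewrite Ns in Ss. rewrite Ns0 in Ss0.
  assert (W := pure_orthogonal_swap d s Hd Hs Hds).
  unfold averaged. rewrite !qmulBr, !qmulBl, !qscale_mulr, !qscale_mull.
  assert (T2 : (s * (d * a * d0))%H = (-1) *: (d * s * a * d0)).
  { rewrite !qmulA, W, !qscale_mull. reflexivity. }
  assert (T3 : (s * (s * a * s0))%H = (- M) *: (a * s0)).
  { rewrite !qmulA, Ss, qmul_reall, qscale_mull. reflexivity. }
  assert (T4 : (s * (d * s * a * (d0 * s0)))%H = M *: (d * a * d0 * s0)).
  { rewrite !qmulA, W, !qscale_mull, <- (qmulA d s s), Ss, qmul_realr, !qscale_mull, qscaleA.
    f_equal. ring. }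
  assert (T3' : (s * a * s0 * s0)%H = (- M) *: (s * a)).
  { rewrite <- (qmulA (s * a)%H), Ss0, qmul_realr. reflexivity. }
  assert (T4' : (d * s * a * (d0 * s0) * s0)%H = (- M) *: (d * s * a * d0)).
  { rewrite <- (qmulA (d * s * a)%H), <- (qmulA d0), Ss0, qmul_realr, !qscale_mulr.
    reflexivity. }
  rewrite T2, T3, T4, T3', T4'.
  generalize (s * a)%H (a * s0)%H (d * s * a * d0)%H (d * a * d0 * s0)%H. clear. qring.
Qed.

(* The averaging operator is a multiple of a projection of trace 4 h M, because
   a -> x * a * y has trace 4 (Re x) (Re y). *)
Lemma averaged_nonzero h M d s d0 s0 :
  orthogonal_pair h M d s -> 0 < h -> 0 < M ->
  exists a, averaged h M d s d0 s0 a <> qreal 0.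
Proof.
  intros (Hd & Hs & Hds & _ & _) Hh HM.
  set (trace := fun f : quat -> quat => q0 (f (Quat 1 0 0 0)) + q1 (f (Quat 0 1 0 0))
                 + q2 (f (Quat 0 0 1 0)) + q3 (f (Quat 0 0 0 1))).
  assert (Htr : forall x y, trace (fun a => x * a * y)%H = 4 * (q0 x * q0 y)).
  { unfold trace. clear. qring. }
  assert (E : trace (averaged h M d s d0 s0) = 4 * (h * M)
     - M * trace (fun a => d * a * d0)%H - h * trace (fun a => s * a * s0)%H
     - trace (fun a => (d * s) * a * (d0 * s0))%H).
  { unfold trace, averaged. cbn [q0 q1 q2 q3 qsub qscale]. ring. }
  rewrite !Htr, Hd, Hs, Hds in E.
  apply NNPP. intros Hn.
  assert (Z0 : forall a, averaged h M d s d0 s0 a = qreal 0).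
  { intros a. apply NNPP. intros Ha. apply Hn. eauto. }
  unfold trace in E. rewrite !Z0 in E. cbn [qreal q0 q1 q2 q3] in E. nia.
Qed.

Lemma intertwiner_exists h M d s d0 s0 :
  orthogonal_pair h M d s -> orthogonal_pair h M d0 s0 -> 0 < h -> 0 < M ->
  exists q, qcont q = 1 /\ (q * d0 = d * q)%H /\ (q * s0 = s * q)%H.
Proof.
  intros Hp Hp0 Hh HM. destruct (averaged_nonzero h M d s d0 s0 Hp Hh HM) as [a Ha].
  assert (E1 := averaged_intertwines_fst h M d s d0 s0 a Hp Hp0).
  assert (E2 := averaged_intertwines_snd h M d s d0 s0 a Hp Hp0).
  destruct (primitive_part _ Ha) as (c & q & Hc & Hq & Hcq).
  rewrite Hq, qscale_mull, qscale_mulr in E1, E2.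
  exists q. split; auto. split; (apply (qscale_cancel c); [lia|auto]).
Qed.

(** * Pairs of lattice points at a fixed distance *)

Definition dot3 (x y : Z * Z * Z) : Z :=
  fst (fst x) * fst (fst y) + snd (fst x) * snd (fst y) + snd x * snd y.

Definition diff_quat (x y : Z * Z * Z) : quat :=
  Quat 0 (fst (fst x) - fst (fst y)) (snd (fst x) - snd (fst y)) (snd x - snd y).

Definition sum_quat (x y : Z * Z * Z) : quat :=
  Quat 0 (fst (fst x) + fst (fst y)) (snd (fst x) + snd (fst y)) (snd x + snd y).

Definition dist2 (x y : Z * Z * Z) : Z := qnorm (diff_quat x y).

(** Fix one pair (x0, y0). Every other pair is sent to a primitive q conjugating the difference and
    sum of the fixed pair to its own, so counting pairs reduces to counting intertwiners. *)
Lemma pairs_at_distance_at_most (X B G n h : Z) :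
  uniform_divisor_bound X B -> 1024 * (n * n) <= X -> 0 < h < 4 * n ->
  (forall f, 0 < f -> (f * f | 16 * h) -> f <= G) ->
  at_most (fun p => dot3 (fst p) (fst p) = n /\ dot3 (snd p) (snd p) = n
                    /\ dist2 (fst p) (snd p) = h)
    (4608 * (B * B * B * B * B) * G).
Proof.
  intros HB HX Hh HG. assert (HB0 : 0 < B) by apply HB.
  assert (HG1 : 1 <= G) by (apply HG; [lia|exists (16 * h); ring]).
  assert (Hfacts : forall x y, dot3 x x = n -> dot3 y y = n -> dist2 x y = h ->
     qnorm (sum_quat x y) = 4 * n - h /\ q0 (diff_quat x y * sum_quat x y)%H = 0).
  { intros [[a b] c] [[a' b'] c']. unfold dot3, dist2, diff_quat, sum_quat, qnorm, qmul.
    cbn [fst snd q0 q1 q2 q3]. intros Hx Hy Hxy. split; lia. }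
  apply at_most_if_inhabited.
  { apply Z.mul_nonneg_nonneg; [|lia]. repeat apply Z.mul_nonneg_nonneg; lia. }
  intros [x0 y0] [Hx0 [Hy0 Hxy0]]. cbn [fst snd] in *.
  destruct (Hfacts x0 y0 Hx0 Hy0 Hxy0) as [HS0 HO0].
  apply (at_most_inj _ (fun q => qcont q = 1 /\ exists d s,
       (q * diff_quat x0 y0 = d * q)%H /\ (q * sum_quat x0 y0 = s * q)%H)
     (fun p q => qcont q = 1 /\ (q * diff_quat x0 y0 = diff_quat (fst p) (snd p) * q)%H /\
        (q * sum_quat x0 y0 = sum_quat (fst p) (snd p) * q)%H)).
  - unfold dist2 in Hxy0.
    (* Both size conditions fit under 1024 n^2, as h (4 n - h) <= 4 n^2 and h < 4 n <= 4 n^2. *)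
    apply (intertwiners_at_most X); auto; rewrite ?HS0, ?Hxy0; auto; try lia; nia.
  - intros [x y] [Hx [Hy Hxy]]. cbn [fst snd] in *.
    destruct (Hfacts x y Hx Hy Hxy) as [HS HO].
    destruct (intertwiner_exists h (4 * n - h) (diff_quat x y) (sum_quat x y)
       (diff_quat x0 y0) (sum_quat x0 y0)) as (q & Hq & H1 & H2);
      [repeat split; auto | repeat split; auto | lia | lia |].
    exists q. split; [split; eauto|auto].
  - intros [x y] [x' y'] q _ _. cbn [fst snd].
    intros (Hq & H1 & H2) (_ & H1' & H2').
    assert (HN := primitive_norm_pos q Hq).
    (* q is invertible over the rationals, so it determines x - y and x + y, hence x and y. *)
    assert (Hcancel : forall u v, (u * q = v * q)%H -> u = v).
    { intros u v H. apply (f_equal (fun z => z * qconj q)%H) in H.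
      rewrite <- !qmulA, !qmul_conjr, !qmul_realr in H. eapply qscale_cancel; [|exact H]. lia. }
    assert (ED : diff_quat x y = diff_quat x' y') by (apply Hcancel; congruence).
    assert (ES : sum_quat x y = sum_quat x' y') by (apply Hcancel; congruence).
    destruct x as [[a b] c], y as [[a1 b1] c1], x' as [[a2 b2] c2], y' as [[a3 b3] c3].
    unfold diff_quat, sum_quat in *. cbn [fst snd] in *.
    injection ED as D1 D2 D3. injection ES as S1 S2 S3.
    repeat f_equal; lia.
Qed.

(** * Square divisors and summation over the distances *)

Definition square_root_part (m : Z) : Z :=
  fold_right Z.max 1 (filter (fun g => m mod (g * g) =? 0) (Zrange 1 m)).

Lemma fold_max_spec (l : list Z) :
  let g := fold_right Z.max 1 l in (g = 1 \/ In g l) /\ forall f, In f l -> f <= g.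
Proof.
  induction l as [|a l [IH1 IH2]]; simpl; [split; [auto|intros f []]|].
  split.
  - destruct (Z.max_spec a (fold_right Z.max 1 l)) as [[_ ->]|[_ ->]]; tauto.
  - intros f [->|Hf]; [lia|]. specialize (IH2 f Hf). lia.
Qed.

Lemma square_root_part_spec (m : Z) :
  0 < m ->
  0 < square_root_part m /\ (square_root_part m * square_root_part m | m) /\
  forall f, 0 < f -> (f * f | m) -> f <= square_root_part m.
Proof.
  intros Hm. unfold square_root_part.
  destruct (fold_max_spec (filter (fun g => m mod (g * g) =? 0) (Zrange 1 m))) as [H1 H2].
  set (g := fold_right _ _ _) in *. clearbody g.
  assert (Hg : 0 < g /\ (g * g | m)).
  { destruct H1 as [->|H1]; [split; [lia|exists m; ring]|].
    apply filter_In in H1. destruct H1 as [H1 H3]. apply in_Zrange in H1.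
    split; [lia|]. apply Z.mod_divide; [nia|]. now apply Z.eqb_eq. }
  split; [tauto|]. split; [tauto|].
  intros f Hf Hd. apply H2. apply filter_In. split.
  - apply in_Zrange. apply Z.divide_pos_le in Hd; nia.
  - apply Z.eqb_eq. apply Z.mod_divide; [nia|auto].
Qed.

(** A sum of nonnegative integers counts the lattice points under the graph of [F], so it can be
    bounded by the counting lemmas. *)
Lemma Zsum_le_at_most (L : list Z) (F : Z -> Z) (C : Z) :
  NoDup L -> (forall u, In u L -> 0 <= F u) ->
  at_most (fun p => In (fst p) L /\ 1 <= snd p <= F (fst p)) C ->
  Zsum (map F L) <= C.
Proof.
  intros HL HF HC.
  assert (H : exists l, NoDup l /\ (forall p, In p l -> In (fst p) L /\ 1 <= snd p <= F (fst p))
                 /\ Z.of_nat (length l) = Zsum (map F L)).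
  { clear HC. induction L as [|u L IH].
    - exists nil. split; [constructor|]. split; [intros p []|reflexivity].
    - inversion HL as [|? ? Hu HL']; subst.
      destruct IH as (l & H1 & H2 & H3); [auto|intros; apply HF; simpl; auto|].
      exists (map (pair u) (Zrange 1 (F u)) ++ l). split; [|split].
      + apply NoDup_app; auto.
        * apply Injective_map_NoDup; [|apply NoDup_Zrange]. intros a b E. congruence.
        * intros p Hp Hpl. apply in_map_iff in Hp. destruct Hp as (i & <- & Hi).
          apply H2 in Hpl. simpl in Hpl. tauto.
      + intros p Hp. apply in_app_iff in Hp. destruct Hp as [Hp|Hp].
        * apply in_map_iff in Hp. destruct Hp as (i & <- & Hi). apply in_Zrange in Hi.
          simpl. auto.
        * apply H2 in Hp. simpl. tauto.
      + rewrite length_app, length_map, Nat2Z.inj_add, H3, length_Zrange.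
        * simpl. lia.
        * specialize (HF u (or_introl eq_refl)). lia. }
  destruct H as (l & H1 & H2 & H3). rewrite <- H3. apply HC; auto.
Qed.

(* With 16 h = g^2 t, the pair (h, i), 1 <= i <= g, is sent to the multiple
   m = g ((t - 1) g + i) <= 16 h of g. *)
Lemma sum_square_root_part_le (X B H : Z) :
  uniform_divisor_bound X B -> 0 <= H -> 16 * H <= X ->
  Zsum (map (fun h => square_root_part (16 * h)) (Zrange 1 H)) <= 16 * H * B.
Proof.
  intros HB HH HX. assert (HB0 : 0 < B) by apply HB.
  apply Zsum_le_at_most; [apply NoDup_Zrange| |].
  { intros u Hu. apply in_Zrange in Hu.
    destruct (square_root_part_spec (16 * u)) as [H1 _]; lia. }
  apply (at_most_rel _ (fun m => 1 <= m <= 16 * H)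
    (fun p m => exists t, 0 < t /\
       16 * fst p = square_root_part (16 * fst p) * square_root_part (16 * fst p) * t /\
       m = square_root_part (16 * fst p) * ((t - 1) * square_root_part (16 * fst p) + snd p))).
  - eapply at_most_impl; [apply (at_most_Zrange 1 (16 * H)); lia|auto|lia].
  - lia.
  - intros [h i] [Hh Hi]. cbn [fst snd] in *. apply in_Zrange in Hh.
    destruct (square_root_part_spec (16 * h)) as (Hg & [t Ht] & _); [lia|].
    set (g := square_root_part (16 * h)) in *.
    assert (Ht0 : 0 < t) by nia.
    exists (g * ((t - 1) * g + i)). split.
    + split; [nia|]. assert ((t - 1) * g + i <= t * g) by nia. nia.
    + exists t. split; [auto|]. split; [lia|auto].
  - intros m Hm.
    (* g is one of the at most [B] divisors of m. Then m / g = (t - 1) g + i with 1 <= i <= g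
       determines t and i, and 16 h = g^2 t determines h. *)
    apply (at_most_inj _ (fun g => 0 < g /\ (g | m)) (fun p g => g = square_root_part (16 * fst p))).
    + apply HB. lia.
    + intros [h i] [[Hh Hi] (t & Ht & E & ->)]. cbn [fst snd] in *. apply in_Zrange in Hh.
      eexists. split; [|reflexivity].
      destruct (square_root_part_spec (16 * h)) as (Hg & _ & _); [lia|].
      split; [auto|apply Z.divide_factor_l].
    + intros [h i] [h' i'] g [[_ Hi] (t & Ht & E & Em)] [[_ Hi'] (t' & Ht' & E' & Em')] Hg Hg'.
      cbn [fst snd] in *. rewrite <- Hg in *. rewrite <- Hg' in *.
      assert (Eq : (t - 1) * g + i = (t' - 1) * g + i').
      { apply (Z.mul_cancel_l _ _ g); lia. }
      assert (t = t') by nia. subst t'. f_equal; lia.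
Qed.

Lemma Zsum_app (l l' : list Z) : Zsum (l ++ l') = Zsum l + Zsum l'.
Proof. unfold Zsum. induction l as [|a l IH]; simpl; [auto|rewrite IH; ring]. Qed.

Lemma Zsum_scale {U} (c : Z) (F : U -> Z) (L : list U) :
  Zsum (map (fun u => c * F u) L) = c * Zsum (map F L).
Proof. unfold Zsum. induction L as [|a l IH]; simpl; [ring|rewrite IH; ring]. Qed.

(** The pairs are sorted by h = |x - y|^2, which is at most 4 n; the degenerate values 0 and 4 n are
    counted apart, by [R3]. *)
Theorem close_pairs_at_most (B n H : Z) :
  0 < n -> 0 <= H -> uniform_divisor_bound (1024 * (n * n)) B ->
  at_most (fun p => dot3 (fst p) (fst p) = n /\ dot3 (snd p) (snd p) = n
                    /\ dist2 (fst p) (snd p) <= H)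
    (B ^ 6 * (48 * Z.sqrt n + 73728 * H)).
Proof.
  intros Hn HH HB. assert (HB0 : 0 < B) by apply HB.
  set (X := 1024 * (n * n)) in *.
  set (R3 := (2 * Z.sqrt n + 1) * (8 * B * B)).
  set (H' := Z.min H (4 * n - 1)). set (C := 4608 * (B * B * B * B * B)).
  assert (HC0 : 0 <= C) by (unfold C; apply Z.mul_nonneg_nonneg; [lia|];
    repeat apply Z.mul_nonneg_nonneg; lia).
  set (F := fun h => if ((0 <? h) && (h <? 4 * n))%bool
                     then C * square_root_part (16 * h) else R3).
  assert (Hpar : forall x y, dot3 x x = n -> dot3 y y = n ->
            qnorm (sum_quat x y) = 4 * n - dist2 x y).
  { intros [[a b] c] [[a' b'] c']. unfold dot3, dist2, diff_quat, sum_quat, qnorm.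
    cbn [fst snd q0 q1 q2 q3]. intros Hx Hy. lia. }
  eapply at_most_le; [apply (at_most_fibers _ (fun p h => h = dist2 (fst p) (snd p))
      ([0; 4 * n] ++ Zrange 1 H') F)|].
  - intros [x y] (Hx & Hy & Hd). cbn [fst snd] in *. eexists. split; [|reflexivity].
    assert (H1 := Hpar x y Hx Hy). assert (H2 := qnorm_nonneg (sum_quat x y)).
    assert (H3 : 0 <= dist2 x y) by apply qnorm_nonneg.
    apply in_app_iff. rewrite in_Zrange. cbn [In]. lia.
  - intros h Hh. unfold F.
    destruct (((0 <? h) && (h <? 4 * n))%bool) eqn:Eh.
    + apply andb_prop in Eh. destruct Eh as [E1%Z.ltb_lt E2%Z.ltb_lt].
      destruct (square_root_part_spec (16 * h)) as (_ & _ & Hmax); [lia|].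
      eapply at_most_impl;
        [apply (pairs_at_distance_at_most X B (square_root_part (16 * h)) n h HB);
           auto; unfold X; lia
        | | apply Z.le_refl].
      intros [x y] [(Hx & Hy & _) E]. cbn [fst snd] in *. auto.
    + assert (Eh' : h = 0 \/ h = 4 * n).
      { apply in_app_iff in Hh. destruct Hh as [Hh|Hh]; [cbn [In] in Hh; lia|].
        apply in_Zrange in Hh. apply Bool.andb_false_iff in Eh.
        destruct Eh as [Eh%Z.ltb_ge|Eh%Z.ltb_ge]; lia. }
      (* Here y = x or y = -x, so x determines the pair. *)
      apply (at_most_inj _ (fun x => dot3 x x = n) (fun p x => x = fst p)).
      * apply (three_squares_at_most X); auto. unfold X. nia.
      * intros [x y] [(Hx & _) _]. eauto.
      * intros [x y] [x' y'] u [(Hx & Hy & _) E] [(Hx' & Hy' & _) E'] Hu Hu'.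
        cbn [fst snd] in *. subst x' u. f_equal.
        destruct Eh' as [->| ->].
        -- symmetry in E, E'. apply qnorm_eq_0 in E, E'.
           destruct x as [[a b] c], y as [[a1 b1] c1], y' as [[a3 b3] c3].
           injection E as D1 D2 D3. injection E' as S1 S2 S3. cbn [fst snd] in *.
           repeat f_equal; lia.
        -- assert (G := Hpar x y Hx Hy). assert (G' := Hpar x y' Hx Hy').
           rewrite <- E, Z.sub_diag in G. rewrite <- E', Z.sub_diag in G'.
           apply qnorm_eq_0 in G, G'.
           destruct x as [[a b] c], y as [[a1 b1] c1], y' as [[a3 b3] c3].
           injection G as D1 D2 D3. injection G' as S1 S2 S3. cbn [fst snd] in *.
           repeat f_equal; lia.
  - rewrite map_app, Zsum_app.
    assert (E1 : Zsum (map F [0; 4 * n]) = 2 * R3).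
    { unfold F. cbn [map]. rewrite !Z.ltb_irrefl, Bool.andb_false_r. cbn [andb Zsum fold_right]. lia. }
    assert (E2 : Zsum (map F (Zrange 1 H')) =
                 C * Zsum (map (fun h => square_root_part (16 * h)) (Zrange 1 H'))).
    { rewrite <- Zsum_scale. f_equal. apply map_ext_in. intros h Hh.
      apply in_Zrange in Hh. unfold F.
      assert (0 <? h = true) as -> by (apply Z.ltb_lt; lia).
      assert (h <? 4 * n = true) as -> by (apply Z.ltb_lt; lia). reflexivity. }
    rewrite E1, E2.
    assert (Hsum := sum_square_root_part_le X B H' HB ltac:(lia) ltac:(unfold X; nia)).
    assert (Hs : 1 <= Z.sqrt n).
    { change 1 with (Z.sqrt 1). apply Z.sqrt_le_mono. lia. }
    assert (HB2 : B * B <= B ^ 6).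
    { replace (B * B) with (B ^ 2) by ring. apply Z.pow_le_mono_r; lia. }
    (* 2 [R3] is at most 2 * 3 * 8 = 48 times B^2 sqrt n because sqrt n >= 1, and 4608 * 16 =
       73728. *)
    apply Z.le_trans with (B ^ 6 * (48 * Z.sqrt n) + C * (16 * H * B)).
    + apply Z.add_le_mono; [unfold R3; nia|].
      apply Z.mul_le_mono_nonneg_l; auto. eapply Z.le_trans; [apply Hsum|].
      apply Z.mul_le_mono_nonneg_r; lia.
    + unfold C. apply Z.eq_le_incl. ring.
Qed.

End Quaternions.

(** * From cells to pairs of points, and the passage to real exponents *)

Open Scope R_scope.

Lemma NoDup_list_prod {T U} (l : list T) (l' : list U) :
  NoDup l -> NoDup l' -> NoDup (list_prod l l').
Proof.
  intros Hl Hl'. induction Hl as [|a l Ha Hl IH]; simpl; [constructor|].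
  apply NoDup_app; auto.
  - apply Injective_map_NoDup; auto. intros x y E. congruence.
  - intros [x y] Hx Hy. apply in_map_iff in Hx. destruct Hx as (z & E & _).
    apply in_prod_iff in Hy. injection E as -> ->. tauto.
Qed.

Lemma NoDup_Elist (n : nat) : NoDup (Elist n).
Proof.
  assert (H : NoDup (zrange n)).
  { unfold zrange. apply Injective_map_NoDup; [|apply seq_NoDup]. intros i j. lia. }
  unfold Elist. apply NoDup_filter. repeat apply NoDup_list_prod; auto.
Qed.

(** The pairs are ordered and include the diagonal, so a cell with c points contributes c^2. As
    cells are disjoint, a pair lies in one block only. *)
Definition same_cell_pairs {I : Type} (A : I -> pt -> Prop) (n : nat) (js : list I) :=
  flat_map (fun j => let F := filter (fun v => decP (A j (embed v))) (Elist n) in list_prod F F) js.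

Lemma in_same_cell_pairs {I} (A : I -> pt -> Prop) n js x y :
  In (x, y) (same_cell_pairs A n js) ->
  In x (Elist n) /\ In y (Elist n) /\ exists j, In j js /\ A j (embed x) /\ A j (embed y).
Proof.
  intros H. apply in_flat_map in H. destruct H as (j & Hj & H).
  apply in_prod_iff in H. rewrite !filter_In, !decP_true in H. firstorder.
Qed.

Lemma NoDup_same_cell_pairs {I} (A : I -> pt -> Prop) n js :
  (forall i j p, A i p -> A j p -> i = j) -> NoDup js -> NoDup (same_cell_pairs A n js).
Proof.
  intros HA Hjs. induction Hjs as [|j js Hj Hjs IH]; [constructor|].
  unfold same_cell_pairs. cbn [flat_map].
  apply NoDup_app; auto.
  - apply NoDup_list_prod; apply NoDup_filter, NoDup_Elist.
  - intros [x y] Hxy Hxy'. apply in_same_cell_pairs in Hxy'.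
    destruct Hxy' as (_ & _ & i & Hi & Hx & _).
    apply in_prod_iff in Hxy. rewrite !filter_In, !decP_true in Hxy.
    apply Hj. rewrite (HA j i (embed x)); tauto.
Qed.

Lemma sum_countE_sqr {I} (A : I -> pt -> Prop) n js :
  sumR (map (fun j => (INR (countE (A j) n)) ^ 2) js) = INR (length (same_cell_pairs A n js)).
Proof.
  induction js as [|j js IH]; [reflexivity|].
  unfold same_cell_pairs in *. cbn [map flat_map sumR fold_right].
  rewrite length_app, length_prod, plus_INR, mult_INR.
  change (fold_right Rplus 0) with sumR. rewrite IH. unfold countE. ring.
Qed.

Lemma dist3_embed (x y : Z * Z * Z) : dist3 (embed x) (embed y) = sqrt (IZR (dist2 x y)).
Proof.
  destruct x as [[a b] c], y as [[a' b'] c']. unfold dist2, diff_quat, qnorm, dist3, embed.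
  cbn [fst snd q0 q1 q2 q3]. f_equal. rewrite !plus_IZR, !mult_IZR, !minus_IZR. ring.
Qed.

Lemma in_Elist_dot3 n x : In x (Elist n) -> dot3 x x = Z.of_nat n.
Proof.
  unfold Elist. intros [_ H]%filter_In. destruct x as [[a b] c]. now apply Z.eqb_eq in H.
Qed.

Lemma quarter_power_sqr (n : nat) :
  (1 <= n)%nat -> Rpower (INR n) (1 / 4) * Rpower (INR n) (1 / 4) = sqrt (INR n).
Proof.
  intros Hn. rewrite <- Rpower_plus. rewrite <- Rpower_sqrt by (apply lt_0_INR; lia).
  f_equal. lra.
Qed.

Lemma Zsqrt_le_sqrt (n : nat) : IZR (Z.sqrt (Z.of_nat n)) <= sqrt (INR n).
Proof.
  assert (H0 := Z.sqrt_nonneg (Z.of_nat n)).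
  rewrite <- (sqrt_square (IZR (Z.sqrt (Z.of_nat n)))) by (now apply IZR_le).
  apply sqrt_le_1_alt. rewrite <- mult_IZR, INR_IZR_INZ. apply IZR_le.
  apply Z.sqrt_spec. lia.
Qed.

Lemma pow_root_bound (b y : R) (k : nat) :
  (0 < k)%nat -> 0 < b -> 0 < y -> b ^ k <= y -> b <= Rpower y (/ INR k).
Proof.
  intros Hk Hb Hy H. assert (Hk' : 0 < INR k) by (apply lt_0_INR; lia).
  replace b with (Rpower (b ^ k) (/ INR k)).
  - apply Rle_Rpower_l; [left; now apply Rinv_0_lt_compat|]. split; auto. now apply pow_lt.
  - rewrite <- Rpower_pow by auto. rewrite Rpower_mult, Rinv_r by lra. now apply Rpower_1.
Qed.

(* B^k <= c n^2 gives B^6 <= c^(6/k) n^(12/k); take k >= 12 / eps. *)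
Lemma divisor_bound_sixth_power (eps : R) :
  0 < eps ->
  exists K, 0 < K /\ forall n : nat, (1 <= n)%nat ->
    exists B, uniform_divisor_bound (1024 * (Z.of_nat n * Z.of_nat n)) B /\
      IZR (B ^ 6) <= K * Rpower (INR n) eps.
Proof.
  intros Heps.
  assert (Hk : exists k, (0 < k)%nat /\ 12 * / INR k <= eps).
  { destruct (INR_unbounded (12 / eps)) as [k Hk].
    assert (Hpos : 0 < 12 / eps) by (apply Rdiv_lt_0_compat; lra).
    assert (Hk0 : (0 < k)%nat) by (apply INR_lt; simpl; lra).
    exists k. split; auto. apply (Rmult_le_reg_r (INR k)); [lra|].
    rewrite Rmult_assoc, Rinv_l by lra. apply (Rmult_lt_compat_r eps) in Hk; auto.
    unfold Rdiv in Hk. rewrite Rmult_assoc, Rinv_l in Hk by lra. lra. }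
  destruct Hk as (k & Hk0 & Hk).
  destruct (uniform_divisor_bound_exists k Hk0) as (c & Hc & Hub).
  set (c' := IZR (c * 1024)).
  assert (Hc' : 0 < c') by (apply IZR_lt; lia).
  exists (Rpower c' (/ INR k) ^ 6). split.
  { apply pow_lt, exp_pos. }
  intros n Hn. assert (Hn0 : 0 < INR n) by (apply lt_0_INR; lia).
  destruct (Hub (1024 * (Z.of_nat n * Z.of_nat n))%Z) as (B & HB & HBk); [nia|].
  exists B. split; auto. assert (HB0 : 0 < IZR B) by (apply IZR_lt, HB).
  assert (H1 : IZR B <= Rpower (c' * (INR n * INR n)) (/ INR k)).
  { apply pow_root_bound; auto.
    - apply Rmult_lt_0_compat; auto. now apply Rmult_lt_0_compat.
    - rewrite pow_IZR. unfold c'. rewrite INR_IZR_INZ, <- !mult_IZR. apply IZR_le. lia. }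
  rewrite <- Rpower_mult_distr in H1 by (auto; now apply Rmult_lt_0_compat).
  assert (H2 : Rpower (INR n * INR n) (/ INR k) = Rpower (INR n) (2 * / INR k)).
  { rewrite <- Rpower_mult. f_equal. replace 2 with (1 + 1) by lra.
    now rewrite Rpower_plus, Rpower_1. }
  rewrite H2 in H1.
  assert (E6 : IZR (B ^ 6) = IZR B ^ 6) by (rewrite pow_IZR; reflexivity).
  rewrite E6. eapply Rle_trans; [apply pow_incr; split; [lra|exact H1]|].
  rewrite Rpow_mult_distr. apply Rmult_le_compat_l; [left; apply pow_lt, exp_pos|].
  rewrite <- Rpower_pow by apply exp_pos. rewrite Rpower_mult.
  apply Rle_Rpower; [replace 1 with (INR 1) by reflexivity; now apply le_INR|].
  simpl. lra.
Qed.

(* The (possibly infinite) sum over j of the nonnegative terms #(A_j ∩ E(n))^2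
   is expressed as: every finite partial sum over distinct indices is bounded. *)
Theorem mainTheorem10 :
  forall C : R, 0 < C ->
  forall eps : R, 0 < eps ->
  exists K : R, 0 < K /\
    forall n : nat, (1 <= n)%nat ->
    forall (I : Type) (A : I -> pt -> Prop),
      is_partition (sphere n) A ->
      (forall j, diam_le (A j) (C * Rpower (INR n) (1 / 4))) ->
      forall js : list I, NoDup js ->
        sumR (map (fun j => (INR (countE (A j) n)) ^ 2) js)
          <= K * Rpower (INR n) (1 / 2 + eps).
Proof.
  intros C HC eps Heps.
  destruct (divisor_bound_sixth_power eps Heps) as (K & HK & HB).
  (* C^2 + 1 arises from H <= C^2 sqrt n + 1 <= (C^2 + 1) sqrt n, with H the integer chosen
     below. *)
  exists (K * (48 + 73728 * (C * C + 1))). split; [nra|].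
  intros n Hn I A (_ & _ & Hdisj) Hdiam js Hjs.
  destruct (HB n Hn) as (B & HBn & HB6).
  assert (Hn1 : 1 <= INR n) by (replace 1 with (INR 1) by reflexivity; now apply le_INR).
  assert (Hsq : 1 <= sqrt (INR n)) by (rewrite <- sqrt_1; now apply sqrt_le_1_alt).
  set (S := sqrt (INR n)) in *.
  set (H := up (C * C * S)).
  destruct (archimed (C * C * S)) as [Hup1 Hup2]. fold H in Hup1, Hup2.
  assert (HH : (0 <= H)%Z) by (apply le_IZR; nra).
  assert (Hlen : (Z.of_nat (length (same_cell_pairs A n js)) <=
             B ^ 6 * (48 * Z.sqrt (Z.of_nat n) + 73728 * H))%Z).
  { apply (close_pairs_at_most B (Z.of_nat n) H); auto; [lia| |].
    - now apply NoDup_same_cell_pairs.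
    - intros [x y] Hxy. apply in_same_cell_pairs in Hxy.
      destruct Hxy as (Hx & Hy & j & _ & Hjx & Hjy). cbn [fst snd].
      split; [now apply in_Elist_dot3|]. split; [now apply in_Elist_dot3|].
      specialize (Hdiam j _ _ Hjx Hjy). rewrite dist3_embed in Hdiam.
      assert (Hd0 : 0 <= IZR (dist2 x y)) by (apply IZR_le, qnorm_nonneg).
      (* Squaring the diameter bound gives |x - y|^2 <= (C n^(1/4))^2 = C^2 sqrt n < H. *)
      apply le_IZR. rewrite <- (sqrt_sqrt (IZR (dist2 x y))) by auto.
      eapply Rle_trans; [apply Rmult_le_compat; eauto using sqrt_pos|].
      assert (Hq := quarter_power_sqr n Hn). fold S in Hq.
      replace (C * Rpower (INR n) (1 / 4) * (C * Rpower (INR n) (1 / 4)))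
        with (C * C * (Rpower (INR n) (1 / 4) * Rpower (INR n) (1 / 4))) by ring.
      rewrite Hq. lra. }
  rewrite sum_countE_sqr, INR_IZR_INZ. apply IZR_le in Hlen.
  eapply Rle_trans; [exact Hlen|].
  rewrite mult_IZR, plus_IZR, !mult_IZR.
  rewrite Rpower_plus. replace (1 / 2) with (/ 2) by lra.
  rewrite Rpower_sqrt by lra. fold S.
  assert (Hz := Zsqrt_le_sqrt n). fold S in Hz.
  assert (HB0 : 0 <= IZR (B ^ 6)).
  { apply IZR_le, Z.pow_nonneg. destruct HBn. lia. }
  replace (K * (48 + 73728 * (C * C + 1)) * (S * Rpower (INR n) eps))
    with ((K * Rpower (INR n) eps) * ((48 + 73728 * (C * C + 1)) * S)) by ring.
  apply Rmult_le_compat; auto.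
  - apply Rplus_le_le_0_compat; apply Rmult_le_pos; try lra.
    + apply IZR_le, Z.sqrt_nonneg.
    + now apply IZR_le.
  - nra.
Qed.
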